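(* Let $n,m$ be integers with $1\le m<n$, let $a,b\in\mathbb{Z}$ be such that $F(x)=x^n+ax^m+b\in\mathbb{Z}[x]$ is irreducible over $\mathbb{Q}$, and let $K=\mathbb{Q}(\theta)$ where $\theta\in\mathbb{C}$ is a root of $F(x)$. Let $p$ be an odd prime such that $p\nmid a$, $p\mid b$ and $p\mid n-m$. Write $n-m=u\cdot p^k$ with $p\nmid u$, and set $\delta=\nu_p(b)$ and $\kappa=\nu_p(a^{p-1}-1)$. Suppose that for some positive integer $d$ one of the following conditions holds: (1) $\delta<\min\{\kappa,k+1\}$ and $N_p(d)<\delta\,N_p(d,u,a)$; (2) $\kappa<\min\{\delta,k+1\}$ and $N_p(d)<\kappa\,N_p(d,u,a)$; (3) $\kappa=\delta\le k$ and $N_p(d)<\kappa\,N_p(d,u,a)\left[m,\frac{b}{a+(-a)^{p^k}}\right]$; (4) $k+1\le\min\{\kappa,\delta\}$ and $N_p(d)<(k+1)\,N_p(d,u,a)$. Then $K$ is not monogenic.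
   Context: A number field $K$ with ring of integers $\mathbb{Z}_K$ is called monogenic if there is $\eta\in\mathbb{Z}_K$ with $\mathbb{Z}_K=\mathbb{Z}[\eta]$. For a prime $p$, $\nu_p$ denotes the $p$-adic valuation (with $\nu_p(0)=\infty$). For positive integers $d,s$ and $t\in\mathbb{Z}$: $N_p(d)$ is the number of monic irreducible polynomials of degree $d$ in $\mathbb{F}_p[x]$; $N_p(d,s,t)$ is the number of monic irreducible factors of degree $d$ of $x^s+\overline{t}$ in $\mathbb{F}_p[x]$; and, for a $p$-integral rational number $c$, $N_p(d,s,t)[m,c]$ is the number of monic irreducible factors of degree $d$ of $x^s+\overline{t}$ in $\mathbb{F}_p[x]$ which do not divide $x^m+\overline{c}$. Here a bar denotes reduction modulo $p$. (In condition (3), one has $\nu_p(a+(-a)^{p^k})=\nu_p(a^{p-1}-1)=\nu_p(b)<\infty$, so the quotient is a $p$-integral rational number of $p$-adic valuation $0$.) *)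

(* Defs.v *)
From HB Require Import structures.
From mathcomp Require Import all_boot all_order all_algebra all_field.
From mathcomp Require Import constructive_ereal.

Set Implicit Arguments.
Unset Strict Implicit.
Unset Printing Implicit Defensive.

Import Order.TTheory GRing.Theory Num.Theory.
Local Open Scope ring_scope.

Definition trinomial (n m : nat) (a b : int) : {poly int} :=
  'X^n + a *: 'X^m + b%:P.

Definition is_alg_int (K : fieldExtType rat) (x : K) : Prop :=
  integralOver (fun z : int => z%:~R : K) x.

(* As eta is an algebraic integer, Z[eta] is contained in the ring of integers,
   so only the reverse inclusion has to be required. *)
Definition monogenic (K : fieldExtType rat) : Prop :=
  exists2 eta : K, is_alg_int eta &
    forall x : K, is_alg_int x ->
      exists q : {poly int}, x = (map_poly intr q).[eta].

Definition padic_val (p : nat) (z : int) : \bar int :=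
  if z == 0 then +oo%E else ((logn p `|z|%N)%:Z)%:E.

(* In the definitions below p is meant to be prime: for other p, 'F_p is the
   field of integers modulo the least prime divisor of p. *)
Definition monic_irr (p d : nat) : {set {poly_d.+1 'F_p}} :=
  [set q : {poly_d.+1 'F_p} | [&& size q == d.+1,
                                  (q : {poly 'F_p}) \is monic & irreducibleb q]].

Definition nb_irr (p d : nat) : nat := #|monic_irr p d|.

Definition nb_irr_factors (p d s : nat) (t : int) : nat :=
  #|[set q in monic_irr p d |
      (q : {poly 'F_p}) %| 'X^s + (t%:~R : 'F_p)%:P]|.

(* [ratr c : 'F_p] is numq c / denq c computed in 'F_p, which is the reduction
   of c modulo p when c is p-integral. *)
Definition nb_irr_factors_ndvd (p d s : nat) (t : int) (m : nat) (c : rat)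
    : nat :=
  #|[set q in monic_irr p d |
      ((q : {poly 'F_p}) %| 'X^s + (t%:~R : 'F_p)%:P) &&
      ~~ ((q : {poly 'F_p}) %| 'X^m + (ratr c : 'F_p)%:P)]|.

(* Main.v *)
From HB Require Import structures.
Require Import Defs.
From mathcomp Require Import all_boot all_order all_algebra all_field.
From mathcomp Require Import constructive_ereal.
From mathcomp Require Import boolp classical_sets.
From mathcomp Require Import ring_quotient generic_quotient.
From mathcomp Require Import zify ring lra.

(* Fix a valuation ring of the algebraic numbers whose maximal ideal contains
   [p], with valuation [v] normalized by [v p = 1].  Let [alpha] be a root of
   [x ^ u + a].  Expanding [(alpha + x) ^ (u p ^ k)] by the binomial formula
   shows that the Newton polygon of [F (alpha + x)] has [V] segments of negative
   slope, each of height 1 (up to the leftmost one), with [V] equal to [delta],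
   [kappa], [kappa] and [k + 1] in the four cases; their lengths are powers of
   [p] and products [p ^ j (p - 1)].
   Suppose that [Z[eta]] is the ring of integers, and let [g] be the minimal
   polynomial of [eta].  By Dedekind's criterion, if [G] is an irreducible
   factor of [g] mod [p] of multiplicity [e], then the valuation of an element
   of [Z[eta]] is the same at all conjugates of [eta] that reduce to a root of
   [G], and lies in [1 / e Z].  Given an irreducible factor [phi] of [x ^ u + a]
   of degree [d] and a segment of length [s], choose [G] vanishing at the
   reduction of a conjugate of [eta] for which [theta] belongs to [phi] and to
   the segment.  Then [s <= e] and [d <= deg G], whereas at most [d s]
   conjugates are available for the [e deg G] that reduce to a root of [G]:
   hence [deg G = d].  As [G] determines [phi] and the segment, [V] times the
   number of the [phi] is at most [N_p (d)]. *)

Set Implicit Arguments.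
Unset Strict Implicit.
Unset Printing Implicit Defensive.

Import Order.TTheory GRing.Theory Num.Theory.
Local Open Scope ring_scope.

(** * Valuation rings *)

(** One place of the algebraic numbers sees all the primes of [K] above [p]: they show up as the
    residue classes of the conjugates of [eta], so the argument stays with polynomials and their
    values. The root [alpha] need not lie in [K], hence [theta - alpha] cannot be written as a
    polynomial in [eta]. Its substitute is [theta ^ u + a]: as [x ^ u + a] is separable mod [p], at
    a conjugate close to [alpha] all its factors except [theta - alpha] are units, and both elements
    have the same valuation. The height [V] comes from the constant coefficient
    [alpha ^ m (a + (- a) ^ (p ^ k)) + b] of [F (alpha + x)], where [a + (- a) ^ (p ^ k)] has
    valuation [kappa]. In cases (1) and (2) one term dominates. In case (3) both have valuation [V]
    and may cancel modulo a higher power; the factors [phi] for which they do are those that the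
    count leaves out. In case (4) the steepest segment consists of a single root, located by an
    inequality only. For [V <= k] the two leftmost segments have lengths [p ^ j] and
    [p ^ j (p - 1)]: an odd [p] keeps their slopes apart. *)

Section MaximalSubring.

Variables (F : fieldType) (t : F).

Definition is_subring (S : set F) : Prop :=
  [/\ S 1, forall x y, S x -> S y -> S (x - y)
    & forall x y, S x -> S y -> S (x * y)].

Definition adjoin (S : set F) (x : F) : set F :=
  fun z => exists2 q : {poly F}, (forall i, S q`_i) & z = q.[x].

Section Closure.

Variables (S : set F) (ringS : is_subring S).

Lemma subring0 : S 0.
Proof. by case: ringS => S1 SB _; rewrite -(subrr 1); apply: SB. Qed.

Lemma subringB x y : S x -> S y -> S (x - y).
Proof. by case: ringS => _ SB _; apply: SB. Qed.

Lemma subringM x y : S x -> S y -> S (x * y).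
Proof. by case: ringS => _ _; apply. Qed.

Lemma subringN x : S x -> S (- x).
Proof. by move=> Sx; rewrite -sub0r; apply: subringB => //; apply: subring0. Qed.

Lemma subringD x y : S x -> S y -> S (x + y).
Proof. by move=> Sx Sy; rewrite -(opprK y); apply: subringB => //; apply: subringN. Qed.

Lemma subringX x n : S x -> S (x ^+ n).
Proof.
move=> Sx; elim: n => [|n IHn]; first by case: ringS.
by rewrite exprS; apply: subringM.
Qed.

Lemma subring_sum (I : Type) (r : seq I) (P : pred I) (f : I -> F) :
  (forall i, P i -> S (f i)) -> S (\sum_(i <- r | P i) f i).
Proof.
move=> Sf; apply: big_ind => //; first exact: subring0.
exact: subringD.
Qed.

Lemma adjoin_subring x : is_subring (adjoin S x).
Proof.
split.
- exists 1; last by rewrite hornerC.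
  by move=> i; rewrite coef1; case: eqP => _ /=; [case: ringS | apply: subring0].
- move=> _ _ [q Sq ->] [r Sr ->]; exists (q - r); last by rewrite !hornerE.
  by move=> i; rewrite coefB; apply: subringB.
- move=> _ _ [q Sq ->] [r Sr ->]; exists (q * r); last by rewrite hornerM.
  by move=> i; rewrite coefM; apply: subring_sum => j _; apply: subringM.
Qed.

Lemma sub_adjoin x : (S `<=` adjoin S x)%classic.
Proof.
move=> y Sy; exists y%:P; last by rewrite hornerC.
by move=> i; rewrite coefC; case: eqP => // _; apply: subring0.
Qed.

Lemma mem_adjoin x : adjoin S x x.
Proof.
exists 'X; last by rewrite hornerX.
by move=> i; rewrite coefX; case: eqP => _ /=; [case: ringS | apply: subring0].
Qed.

End Closure.

(** Zorn's lemma; [t] will be [1 / p]. The last clause is maximality in the form used later: any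
    element outside [S] generates [t] over [S]. *)
Lemma maximal_subring_avoiding (S0 : set F) :
    is_subring S0 -> ~ S0 t ->
  exists S : set F, [/\ (S0 `<=` S)%classic, is_subring S, ~ S t
    & forall x, ~ S x -> adjoin S x t].
Proof.
move=> ringS0 S0't.
pose P (X : set F) :=
  X = set0 \/ [/\ (S0 `<=` X)%classic, is_subring X & ~ X t].
have [|S [PS maxS]] := @Zorn_bigcup F P.
  move=> C sCP totC.
  have [[Y [CY /eqP Y0]]|noY] := pselect (exists Y, C Y /\ Y != set0); last first.
    left; apply/seteqP; split=> // x [Y CY Yx]; case: noY.
    by exists Y; split=> //; apply/set0P; exists x.
  have good X x : C X -> X x -> [/\ (S0 `<=` X)%classic, is_subring X & ~ X t].
    by move=> CX Xx; case: (sCP X CX) => // X0; rewrite X0 in Xx.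
  have [y Yy] : exists y, Y y by apply/set0P/eqP.
  have [sS0Y [Y1 _ _] _] := good _ _ CY Yy.
  right; split.
  - by move=> x /sS0Y Yx; exists Y.
  - have both x z : (\bigcup_(X in C) X)%classic x ->
        (\bigcup_(X in C) X)%classic z -> exists X, [/\ C X, X x & X z].
      move=> [X CX Xx] [Z CZ Zz].
      by case: (totC X Z CX CZ) => sXZ; [exists Z | exists X]; split=> //; apply: sXZ.
    split; first by exists Y.
    + move=> x z Ux Uz; have [X [CX Xx Xz]] := both x z Ux Uz.
      by exists X => //; have [_ [_ XB _] _] := good _ _ CX Xx; apply: XB.
    + move=> x z Ux Uz; have [X [CX Xx Xz]] := both x z Ux Uz.
      by exists X => //; have [_ [_ _ XM] _] := good _ _ CX Xx; apply: XM.
  - by move=> [X CX Xt]; have [_ _ []] := good _ _ CX Xt.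
have maxS' T : (S `<=` T)%classic -> P T -> (T `<=` S)%classic.
  move=> sST PT; apply: contrapT => nTS; apply: (maxS T) => //.
have [S_0|[sS0S ringS S't]] := PS.
  have : (S0 `<=` S)%classic by apply: maxS'; [move=> x; rewrite S_0 | right; split].
  rewrite S_0 => s0; have [S01 _ _] := ringS0; by case: (s0 1 S01).
exists S; split=> // x S'x; apply: contrapT => nt; apply: S'x.
apply: (maxS' (adjoin S x)); last exact: mem_adjoin.
  exact: sub_adjoin.
right; split=> //; last exact: adjoin_subring.
by move=> y /sS0S Sy; apply: sub_adjoin.
Qed.

(* Any subring maximal among those avoiding [1 / p], for a nonunit [p] of it,
   is a valuation ring: [p S] lies in its Jacobson radical, and two relations
   [1 \in p S[x]], [1 \in p S[1 / x]] of minimal degrees shorten each other. *)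
Lemma valuation_of_maximal (S : set F) : is_subring S -> S t^-1 -> ~ S t ->
    (forall x, ~ S x -> adjoin S x t) ->
  forall x, S x \/ S x^-1.
Proof.
move=> ringS Sp S't maxS x; set p := t^-1 in Sp.
have t_neq0 : t != 0 by apply: contra_notN S't => /eqP->; apply: subring0.
have [S1 _ _] := ringS.
(* Otherwise [t] is a polynomial in [w^-1], where [w = 1 - p y]; clearing denominators puts
   [t w ^ n] in [S]. But [w ^ n = 1 - p s] with [s] in [S], so [t w ^ n = t - s] and [t] would be in
   [S]. *)
have jac y : S y -> S (1 - p * y)^-1.
  move=> Sy; apply: contrapT => /maxS[q Sq Dt].
  have [e0|ne0] := eqVneq (1 - p * y) 0.
    by apply: S't; suff <-: y = t by []; move/eqP: e0; rewrite subr_eq0 /p => /eqP e0;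
       rewrite -[y]mul1r -(mulfV t_neq0) -mulrA -e0 mulr1.
  set w := 1 - p * y in Dt ne0; have Sw : S w by apply: subringB => //; apply: subringM.
  pose n := size q.
  have St : S (t * w ^+ n).
    rewrite Dt horner_coef mulr_suml; apply: subring_sum => // i _.
    rewrite -mulrA; apply: subringM => //.
    rewrite -[X in w ^+ X](subnKC (ltnW (ltn_ord i))) exprD mulrA.
    rewrite -exprMn mulVf // expr1n mul1r.
    exact: subringX.
  have [s Ss Dw] : exists2 s, S s & w ^+ n = 1 - p * s.
    elim: {St}n => [|n [s Ss IH]]; first by exists 0; [apply: subring0 | rewrite mulr0 subr0].
    exists (s + y - p * s * y); last by rewrite exprS IH /w; ring.
    by apply: subringB; [| apply: subringD | apply: subringM => //; apply: subringM].
  apply: S't; rewrite -[t](subrK s); apply: subringD => //.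
  suff ->: t - s = t * w ^+ n by [].
  by rewrite Dw mulrBr mulr1 mulrA mulfV // mul1r.
have rel z : ~ S z -> exists n, exists2 q : nat -> F, (forall i, S (q i)) &
     1 = p * \sum_(i < n) q i * z ^+ i.
  move=> /maxS[q Sq Dt]; exists (size q); exists (fun i => q`_i) => //.
  by rewrite -horner_coef -Dt mulVf.
have [x0|x_neq0] := eqVneq x 0; first by left; rewrite x0; apply: subring0.
apply: contrapT => /not_orP[S'x S'x1].
pose Rel z n := `[< exists2 q : nat -> F, (forall i, S (q i)) &
     1 = p * \sum_(i < n) q i * z ^+ i >].
have exR z : ~ S z -> exists n, Rel z n.
  by move=> /rel[n Rn]; exists n; apply/asboolP.
suff shorten z n m : z != 0 -> (m <= n)%N -> Rel z n -> Rel z^-1 m ->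
    exists2 n', (n' < n)%N & Rel z n'.
  case: (ex_minnP (exR _ S'x)) => n Rn minn.
  case: (ex_minnP (exR _ S'x1)) => m Rm minm.
  case: (leqP m n) => [lemn | /ltnW lenm].
    have [//|n' lt_n' Rn'] := shorten x n m _ lemn Rn Rm.
    by have := minn _ Rn'; rewrite leqNgt lt_n'.
  have [||n' lt_n' Rn'] := shorten x^-1 m n _ lenm Rm; rewrite ?invr_eq0 ?invrK //.
  by have := minm _ Rn'; rewrite leqNgt lt_n'.
move=> z0; case: m => [|m] lemn /asboolP[q Sq Dq] /asboolP[r Sr Dr].
  by move: Dr; rewrite big_ord0 mulr0 => /eqP; rewrite oner_eq0.
case: n lemn Dq => // n lemn Dq; exists n => //; apply/asboolP.
have Sw := jac _ (Sr 0%N); set w := (1 - p * r 0%N)^-1 in Sw.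
have w0 : 1 - p * r 0%N != 0.
  apply: contra_notN S't; rewrite subr_eq0 /p => /eqP e0.
  suff <-: r 0%N = t by [].
  by rewrite -[LHS]mul1r -(mulfV t_neq0) -mulrA -e0 mulr1.
(* The relation for [z^-1], multiplied by [w z ^ n]: since [m <= n] it rewrites the top power of the
   relation for [z] through lower ones. *)
have Dz : z ^+ n = p * \sum_(i < m) w * r i.+1 * z ^+ (n - i.+1)%N.
  transitivity (w * (1 - p * r 0%N) * z ^+ n); first by rewrite mulVf // mul1r.
  have -> : 1 - p * r 0%N = p * \sum_(i < m) r i.+1 * z^-1 ^+ i.+1.
    by rewrite {1}Dr big_ord_recl expr0 mulr1; ring.
  rewrite mulrCA -!mulrA; congr (p * _); rewrite mulrA mulr_sumr mulr_suml.
  apply: eq_bigr => i _ /=.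
  have lein : (i < n)%N by rewrite (leq_trans (ltn_ord i)).
  rewrite -!mulrA; congr (_ * (_ * _)); rewrite -[X in z ^+ X](subnKC lein) exprD mulrA.
  by rewrite -exprMn mulVf // expr1n mul1r.
exists (fun j => q j + q n * p * (\sum_(i < m | (n - i.+1)%N == j) w * r i.+1)).
  move=> i; apply: subringD => //; apply: subringM => //; first exact: subringM.
  by apply: subring_sum => // j _; apply: subringM.
rewrite {1}Dq big_ord_recr /= {1}Dz; congr (p * _).
under [RHS]eq_bigr do rewrite mulrDl.
rewrite big_split /=; congr (_ + _).
rewrite mulrA mulr_sumr.
under [RHS]eq_bigr do rewrite mulr_sumr mulr_suml.
rewrite (exchange_big_dep xpredT) //=; apply: eq_bigr => i _.
have ltin : (n - i.+1 < n)%N by have := ltn_ord i; lia.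
rewrite (big_pred1 (Ordinal ltin)) //=; first by rewrite !mulrA.
Qed.

End MaximalSubring.

(** * The maximal ideal and the residue field of a valuation ring *)

Section ResidueField.

Variables (F : fieldType) (O : set F).
Hypotheses (ringO : is_subring O) (valO : forall x, O x \/ O x^-1).

Definition in_valring : {pred F} := [pred x | `[< O x >]].

Fact in_valring_closed : subring_closed in_valring.
Proof.
split=> [|x y /asboolP Ox /asboolP Oy|x y /asboolP Ox /asboolP Oy].
- by apply/asboolP; case: ringO.
- by apply/asboolP; apply: subringB.
- by apply/asboolP; apply: subringM.
Qed.

HB.instance Definition _ :=
  GRing.isSubringClosed.Build F in_valring in_valring_closed.

Record valring := Valring { valring_val : F; _ : valring_val \in in_valring }.
HB.instance Definition _ := [isSub for valring_val].
HB.instance Definition _ := [Choice of valring by <:].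
HB.instance Definition _ := [SubChoice_isSubComNzRing of valring by <:].

(** The nonunits. Zero is listed separately because [0^-1 = 0] does lie in [O]. *)
Definition in_maxideal : {pred valring} := [pred x | `[< ~ O (val x)^-1 \/ val x = 0 >]].

Lemma in_maxidealP (x : valring) :
  reflect (val x = 0 \/ ~ O (val x)^-1) (x \in in_maxideal).
Proof.
by apply: (iffP (asboolP _)) => -[]; [right|left|right|left].
Qed.

Lemma valringP (x : valring) : O (val x).
Proof. by case: x => x /= /asboolP. Qed.

Fact maxideal_zmod_closed : zmod_closed in_maxideal.
Proof.
split=> [|x y]; first by apply/in_maxidealP; left; rewrite rmorph0.
(* One of the two quotients is integral, say [x / y]; then an integral inverse of [x - y] would make
   [y^-1 = (x / y - 1) (x - y)^-1] integral. *)
wlog suff: x y / val y != 0 -> O (val x / val y) -> x \in in_maxideal -> y \in in_maxideal ->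
    x - y \in in_maxideal.
  move=> IH Ix Iy; have [y0|y0] := eqVneq (val y) 0.
    have ->: y = 0 by apply: val_inj; rewrite rmorph0.
    by rewrite subr0.
  have [x0|x0] := eqVneq (val x) 0.
    have ->: x = 0 by apply: val_inj; rewrite rmorph0.
    rewrite sub0r; case/in_maxidealP: Iy => [e|Iy]; first by rewrite e eqxx in y0.
    apply/in_maxidealP; right; rewrite rmorphN invrN => O1; apply: Iy.
    by rewrite -[_^-1]opprK; apply: subringN.
  have [Oxy|] := valO (val x / val y); first exact: IH.
  rewrite invf_div => Oyx; have := IH y x x0 Oyx Iy Ix.
  have Exy : val (x - y) = - val (y - x) by rewrite -opprB rmorphN.
  case/in_maxidealP => [e|I1]; apply/in_maxidealP; rewrite Exy.
    by left; rewrite e oppr0.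
  right=> O1; apply: I1; rewrite -[_^-1]opprK -invrN; exact: subringN.
move=> y0 Oxy Ix /in_maxidealP[/eqP|Iy]; first by rewrite (negPf y0).
have [e|n0] := eqVneq (val (x - y)) 0; apply/in_maxidealP; [by left | right => O1].
apply: Iy; have ->: (val y)^-1 = (val x / val y - 1) * (val (x - y))^-1.
  rewrite -[1](mulfV y0) -mulrBl.
  have ->: val x - val y = val (x - y) by rewrite rmorphB.
  by rewrite mulrAC mulfV // mul1r.
by apply: subringM => //; apply: subringB => //; case: ringO.
Qed.

Fact maxideal_idealr_closed : idealr_closed in_maxideal.
Proof.
have [I0 IB] := maxideal_zmod_closed; split=> // [|x u v Iu Iv].
  apply/in_maxidealP; rewrite rmorph1 invr1 => -[/eqP|]; first by rewrite oner_eq0.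
  by apply; case: ringO.
suff IM : x * u \in in_maxideal.
  by rewrite -[v]opprK -[- v]sub0r; apply: (IB) => //; apply: (IB).
move: Iu => /in_maxidealP[u0|Iu]; apply/in_maxidealP.
  by left; rewrite rmorphM /= u0 mulr0.
have [e|n0] := eqVneq (val (x * u)) 0; [by left | right => O1].
move: n0 O1; rewrite rmorphM /= mulf_eq0 negb_or => /andP[x0 u0].
rewrite invfM => O1; apply: Iu; rewrite -[_^-1]mul1r -(mulfV x0) -mulrA.
by apply: subringM => //; apply: valringP.
Qed.

HB.instance Definition _ :=
  isIdealr.Build valring in_maxideal maxideal_idealr_closed.

Definition resfield := {ideal_quot in_maxideal}.
HB.instance Definition _ := GRing.ComNzRing.on resfield.

Local Open Scope quotient_scope.

Definition residue (x : valring) : resfield := \pi_(resfield) x.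

Fact residue_zmod_morphism : zmod_morphism residue.
Proof. by move=> x y; rewrite /residue rmorphB. Qed.

Fact residue_monoid_morphism : monoid_morphism residue.
Proof. by split=> [|x y]; rewrite /residue ?rmorph1 ?rmorphM. Qed.

HB.instance Definition _ :=
  GRing.isZmodMorphism.Build valring resfield residue residue_zmod_morphism.
HB.instance Definition _ :=
  GRing.isMonoidMorphism.Build valring resfield residue residue_monoid_morphism.

Lemma residue_eq0 x : (residue x == 0) = (x \in in_maxideal).
Proof.
rewrite -[x in RHS]subr0 Quotient.idealrBE; congr (_ == _).
exact: esym (rmorph0 residue).
Qed.

Lemma residue_int z (Sz : z%:~R \in in_valring) :
  residue (Valring Sz) = z%:~R.
Proof.
rewrite -(rmorph_int residue); congr residue.
by apply: val_inj; rewrite rmorph_int.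
Qed.

Lemma resfield_inverse (z : resfield) : exists w, z != 0 -> w * z = 1.
Proof.
have -> : z = residue (repr z) by rewrite /residue reprK.
set x := repr z; have [x0|x0] := boolP (residue x == 0); first by exists 0.
move: x0; rewrite residue_eq0 => /in_maxidealP/not_orP[/eqP x0 /contrapT Ox].
have Sx : (val x)^-1 \in in_valring by apply/asboolP.
exists (residue (Valring Sx)) => _.
rewrite -rmorphM -(rmorph1 residue); congr residue.
by apply: val_inj; rewrite rmorphM /= mulVf // rmorph1.
Qed.

Definition resfield_inv (z : resfield) : resfield :=
  if z == 0 then 0 else sval (cid (resfield_inverse z)).

Fact resfield_mulVf : forall z, z != 0 -> resfield_inv z * z = 1.
Proof.
by move=> z z0; rewrite /resfield_inv ifN //; case: cid => w /= ->.
Qed.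

Fact resfield_inv0 : resfield_inv 0 = 0.
Proof. by rewrite /resfield_inv ifT. Qed.

HB.instance Definition _ :=
  GRing.ComNzRing_isField.Build resfield resfield_mulVf resfield_inv0.

Definition valring_ring : comNzRingType := valring.
Definition valring_emb : {rmorphism valring_ring -> F} :=
  (val : {rmorphism valring -> F}).
Definition residue_field : fieldType := resfield.
Definition residue_map : {rmorphism valring_ring -> residue_field} :=
  (residue : {rmorphism valring -> resfield}).

Lemma valring_emb_inj : injective valring_emb.
Proof. exact: val_inj. Qed.

Lemma valring_embP x : O x -> exists t, valring_emb t = x.
Proof. move=> Ox; have Sx : x \in in_valring by apply/asboolP.
by exists (Valring Sx).
Qed.

Lemma residue_map_eq0 (t : valring_ring) :
  valring_emb t != 0 -> residue_map t = 0 <-> ~ O (valring_emb t)^-1.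
Proof.
move=> t0; split=> [/eqP|Ot].
  by rewrite residue_eq0 => /in_maxidealP[/eqP|//]; rewrite (negPf t0).
by apply/eqP; rewrite residue_eq0; apply/in_maxidealP; right.
Qed.

Definition valunit (x : F) : Prop := [/\ x != 0, O x & O x^-1].

Lemma valunit1 : valunit 1.
Proof. by split; rewrite ?oner_eq0 ?invr1 //; case: ringO. Qed.

Lemma valunitM x y : valunit x -> valunit y -> valunit (x * y).
Proof.
move=> [x0 Ox Ox1] [y0 Oy Oy1]; split; first by rewrite mulf_neq0.
  exact: subringM.
by rewrite invfM; apply: subringM.
Qed.

Lemma valunitV x : valunit x -> valunit x^-1.
Proof. by move=> [x0 Ox Ox1]; split; rewrite ?invr_eq0 ?invrK. Qed.

Lemma valunitX x n : valunit x -> valunit (x ^+ n).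
Proof.
by move=> Ux; elim: n => [|n IHn]; [apply: valunit1 | rewrite exprS; apply: valunitM].
Qed.

(** Divisibility in a valuation ring is total, so a finite list has an element of least valuation,
    expressed here before any value group exists. *)
Lemma val_minimal (s : seq F) : s != [::] -> 0 \notin s ->
  exists2 x, x \in s & forall y, y \in s -> O (y / x).
Proof.
have O1 x : x != 0 -> O (x / x) by move=> x0; rewrite mulfV //; case: ringO.
case: s => // a s _; elim: s a => [|b s IHs] a.
  rewrite inE => a0; exists a; rewrite ?inE // => y; rewrite inE => /eqP->.
  by apply: O1; rewrite eq_sym.
rewrite inE negb_or eq_sym => /andP[a0 s0].
have [x sx minx] := IHs b s0.
have x0 : x != 0 by apply: contraNneq s0 => <-.
have [Oax|Oxa] := valO (a / x).
  exists x; first by rewrite inE sx orbT.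
  by move=> y; rewrite inE => /orP[/eqP->|/minx].
exists a; first by rewrite inE eqxx.
move=> y; rewrite inE => /orP[/eqP->|/minx Oyx]; first exact: O1.
rewrite invf_div in Oxa.
have -> : y / a = (y / x) * (x / a) by field; rewrite a0 x0.
exact: subringM.
Qed.

(** In a vanishing sum the least valuation occurs twice: with a single least term, dividing by it
    and passing to the residue field would give 1 = 0. *)
Lemma sum0_valunit (n : nat) (f : nat -> F) (k : 'I_n) :
  f k != 0 -> \sum_(i < n) f i = 0 ->
  exists i j, [/\ (i < j)%N, f i != 0, f j != 0 & valunit (f j / f i)].
Proof.
move=> fk0 sum0; pose s := [seq f (nat_of_ord i) | i <- enum 'I_n & f (nat_of_ord i) != 0].
have sP i : (i < n)%N -> f i != 0 -> f i \in s.
  by move=> ltin fi0; apply/mapP; exists (Ordinal ltin); rewrite // mem_filter fi0 mem_enum.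
have [||_ /mapP[i + ->] min_i] := @val_minimal s.
- by apply/eqP => e; have := sP k (ltn_ord k) fk0; rewrite e.
- by apply/mapP => -[i]; rewrite mem_filter => /andP[fi0 _] e; rewrite -e eqxx in fi0.
rewrite mem_filter => /andP[fi0 _].
have Oi j : (j < n)%N -> O (f j / f i).
  move=> ltjn; have [->|fj0] := eqVneq (f j) 0; last exact/min_i/sP.
  by rewrite mul0r; apply: subring0.
suff [j [ne_ji ltjn fj0 Oji]] : exists j, [/\ j != i :> nat, (j < n)%N, f j != 0 & O (f j / f i)^-1].
  have Uji : valunit (f j / f i).
    by split=> //; [rewrite mulf_neq0 ?invr_eq0 | apply: Oi].
  move: ne_ji; rewrite neq_ltn => /orP[lt_ji|lt_ij]; last by exists i, j.
  by exists j, i; split=> //; rewrite -invf_div; apply: valunitV.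
apply: contrapT => no.
have Sj (j : 'I_n) : f j / f i \in in_valring by apply/asboolP/Oi.
pose g (j : 'I_n) := Valring (Sj j).
have : residue (\sum_(j < n) g j) = 0.
  suff -> : \sum_(j < n) g j = 0 by rewrite rmorph0.
  by apply: val_inj; rewrite rmorph_sum rmorph0 /= -mulr_suml sum0 mul0r.
rewrite rmorph_sum (bigD1 i) //= big1 ?addr0.
  have -> : g i = 1 by apply: val_inj; rewrite rmorph1 /= mulfV.
  by rewrite rmorph1 => /eqP; rewrite oner_eq0.
move=> j ne_ji; apply/eqP; rewrite residue_eq0; apply/in_maxidealP => /=.
have [->|fj0] := eqVneq (f j) 0; first by left; rewrite mul0r.
by right=> Oij; apply: no; exists j; split.
Qed.

End ResidueField.

(** Keeps only what the sequel uses of the valuation ring: the valuation is rational-valued, and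
    unconstrained at 0, whence the conditions [x != 0]. *)
Record place (p : nat) := Place {
  pl_ring : comNzRingType;
  pl_res : fieldType;
  pl_pchar : p \in [pchar pl_res];
  pl_emb : {rmorphism pl_ring -> algC};
  pl_red : {rmorphism pl_ring -> pl_res};
  pl_val : algC -> rat;
  pl_emb_inj : injective pl_emb;
  pl_valM : forall x y, x != 0 -> y != 0 -> pl_val (x * y) = pl_val x + pl_val y;
  pl_valp : pl_val p%:R = 1;
  pl_val_ge0 : forall x, x != 0 -> 0 <= pl_val x -> exists t, pl_emb t = x;
  pl_emb_ge0 : forall t, pl_emb t != 0 -> 0 <= pl_val (pl_emb t);
  pl_red_eq0 : forall t, pl_emb t != 0 -> (pl_red t == 0) = (0 < pl_val (pl_emb t))
}.

(** * The rational-valued valuation attached to a valuation ring *)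

Section PlaceExists.

Variables (p : nat) (p_prime : prime p).
Variables (O : set algC).
Hypotheses (ringO : is_subring O) (valO : forall x, O x \/ O x^-1).
Hypothesis (O'p : ~ O p%:R^-1).

Local Notation U := (valunit O).
Local Notation P := (p%:R : algC).

Let P0 : P != 0. Proof. by rewrite pnatr_eq0 -lt0n prime_gt0. Qed.

Lemma valring_nat n : O n%:R.
Proof.
elim: n => [|n IHn]; first exact: subring0.
by rewrite -addn1 natrD; apply: subringD => //; case: ringO.
Qed.

Lemma valring_int (z : int) : O z%:~R.
Proof.
case: z => n; first exact: valring_nat.
by rewrite NegzE rmorphN; apply: subringN => //; apply: valring_nat.
Qed.

Lemma resfield_pchar : p \in [pchar resfield ringO valO].
Proof.
apply/andP; split=> //.
rewrite -(rmorph_nat (residue ringO valO)) residue_eq0.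
by apply/in_maxidealP; right; rewrite rmorph_nat.
Qed.

Lemma valunit_int (z : int) : ~~ (p %| `|z|)%N -> U z%:~R.
Proof.
move=> pNz; have z0 : z != 0 by apply: contraNneq pNz => ->; rewrite dvdn0.
split; first by rewrite intr_eq0.
  exact: valring_int.
apply: contrapT => Oz.
have Sz : z%:~R \in in_valring O by apply/asboolP/valring_int.
have : residue ringO valO (Valring Sz) == 0 by rewrite residue_eq0; apply/in_maxidealP; right.
rewrite residue_int; case: z pNz {z0 Oz Sz} => n /= pNn.
  by rewrite -(dvdn_pcharf resfield_pchar) (negPf pNn).
by rewrite NegzE rmorphN oppr_eq0 -(dvdn_pcharf resfield_pchar) (negPf pNn).
Qed.

Lemma valunit_Pz_eq0 (r : int) : U (P ^ r) -> r = 0.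
Proof.
have pos n : ~ O (P ^- n.+1).
  move=> On; apply: O'p; have -> : P^-1 = P ^+ n * P ^- n.+1.
    by rewrite exprS invfM mulrCA divff ?mulr1 ?expf_neq0.
  by apply: subringM => //; apply: subringX => //; apply: valring_nat.
case: r => [[|n]|n] //= [_ On On1]; [case: (pos n) | case: (pos n)] => //.
Qed.

(** Value [r / s] means that [x ^ s] and [p ^ r] are associates; this describes the valuation
    without constructing a value group. *)
Definition has_val (x : algC) (q : rat) : Prop :=
  exists s : nat, exists2 r : int, (0 < s)%N /\ q = r%:~R / s%:R & U (x ^+ s / P ^ r).

Lemma has_val_uniq x q q' : has_val x q -> has_val x q' -> q = q'.
Proof.
move=> [s [r [s0 ->] Us]] [s' [r' [s'0 ->] Us']].
have x0 : x != 0.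
  by case: Us => + _ _; apply: contraNneq => ->; rewrite expr0n eqn0Ngt s0 mul0r.
suff : r * s' - r' * s = 0.
  move/eqP; rewrite subr_eq0 => /eqP e.
  apply/eqP; rewrite eqr_div ?pnatr_eq0 -?lt0n //.
  by rewrite !pmulrn -!intrM -e.
apply: valunit_Pz_eq0.
have : U ((x ^+ s' / P ^ r') ^+ s / (x ^+ s / P ^ r) ^+ s').
  by apply: valunitM => //; [|apply: valunitV]; apply: valunitX.
have -> : (x ^+ s' / P ^ r') ^+ s / (x ^+ s / P ^ r) ^+ s' = P ^ (r * s' - r' * s).
  rewrite expfzDr // -invr_expz -!exprz_exp -!exprnP.
  rewrite !exprMn !exprVn -!exprM [(s' * s)%N]mulnC invfM invrK mulrACA.
  by rewrite divff ?mul1r ?expf_neq0 // mulrC.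
by [].
Qed.

Lemma has_valM x y q q' : has_val x q -> has_val y q' -> has_val (x * y) (q + q').
Proof.
move=> [s [r [s0 ->] Us]] [s' [r' [s'0 ->] Us']].
exists (s * s')%N; exists (r * s' + r' * s).
  split; first by rewrite muln_gt0 s0.
  rewrite addf_div ?pnatr_eq0 -?lt0n // natrM intrD !intrM !pmulrn.
  by rewrite [r'%:~R * _]mulrC.
have -> : (x * y) ^+ (s * s') / P ^ (r * s' + r' * s) =
    (x ^+ s / P ^ r) ^+ s' * (y ^+ s' / P ^ r') ^+ s.
  rewrite expfzDr // -!exprz_exp -!exprnP !exprMn !exprVn -!exprM invfM.
  by rewrite [(s' * s)%N]mulnC mulrACA.
by apply: valunitM => //; apply: valunitX.
Qed.

Lemma has_valV x q : has_val x q -> has_val x^-1 (- q).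
Proof.
move=> [s [r [s0 ->] Us]]; exists s; exists (- r); first by rewrite rmorphN mulNr.
by rewrite -invr_expz exprVn -invfM; apply: valunitV.
Qed.

Lemma has_val_p : has_val P 1.
Proof.
exists 1%N; exists 1; first by split; rewrite // divr1.
by rewrite expr1 expr1z mulfV //; apply: valunit1.
Qed.

Lemma has_val_ge0 x q : x != 0 -> has_val x q -> (0 <= q) <-> O x.
Proof.
move=> x0 [s [r [s0 ->] Us]].
have -> : (0 <= r%:~R / s%:R :> rat) = (0 <= r).
  by rewrite pmulr_lge0 ?invr_gt0 ?ltr0n // ler0z.
have [_ Os Os1] := Us.
have Pr0 : P ^ r != 0 by rewrite expfz_neq0.
split=> [|Ox].
  case: r {Pr0 Us} Os Os1 => // r Os _ _.
  have Oxs : O (x ^+ s).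
    rewrite -[x ^+ s](divfK (expf_neq0 r P0)); apply: subringM => //.
    by apply: subringX => //; apply: valring_nat.
  have [//|Ox1] := valO x.
  case: s s0 Oxs {Os} => // s _ Oxs.
  have -> : x = x ^+ s.+1 * x^-1 ^+ s by rewrite exprS -mulrA -exprMn divff // expr1n mulr1.
  by apply: subringM => //; apply: subringX.
case: r Pr0 Us Os Os1 => // r _ _ _ Os1; case: O'p.
have -> : P^-1 = (x ^+ s / P ^ (Negz r))^-1 * x ^+ s * P ^+ r.
  by rewrite -[P ^ _]/(P ^- r.+1) exprS; field; rewrite P0 !expf_neq0.
apply: subringM; [by [] | apply: subringM => //; exact: subringX |].
by apply: subringX => //; apply: valring_nat.
Qed.

Lemma has_val_rat (a : rat) : a != 0 -> exists r : int, U (ratr a / P ^ r).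
Proof.
have H (z : int) : z != 0 -> exists r : int, U (z%:~R / P ^ r).
  move=> z0; exists (logn p `|z|%N).
  have [z' Dz pNz'] : exists2 z' : int, z = z' * (p ^ logn p `|z|%N)%N & ~~ (p %| `|z'|)%N.
    have [//|m co_pm Dz] := @pfactor_coprime p `|z|%N p_prime; first by rewrite absz_gt0.
    exists (sgz z * m).
      by rewrite {1}[z]intEsg {1}Dz PoszM mulrA.
    by rewrite abszM absz_sg z0 mul1n -prime_coprime.
  rewrite {1}Dz intrM -pmulrn natrX -exprnP mulfK ?expf_neq0 //.
  exact: valunit_int.
move=> a0; have [|r1 U1] := H (numq a); first by rewrite numq_eq0.
have [r2 U2] := H (denq a) (denq_neq0 a).
exists (r1 - r2); rewrite /ratr expfzDr // -invr_expz.
have -> : (numq a)%:~R / (denq a)%:~R / (P ^ r1 / P ^ r2) =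
   ((numq a)%:~R / P ^ r1) / ((denq a)%:~R / P ^ r2) :> algC.
  by field; rewrite !expfz_neq0 // intr_eq0 denq_eq0.
by apply: valunitM => //; apply: valunitV.
Qed.

(** Values are rational because [x] is algebraic: two terms of its minimal polynomial relation have
    equal valuation, so some power [x ^ (j - i)] is associated to a rational number, hence to a
    power of [p]. *)
Lemma has_val_exists x : x != 0 -> exists q, has_val x q.
Proof.
move=> x0; have [q [Dq mon_q] dv_q] := minCpolyP x.
have rq : root (map_poly ratr q) x by rewrite -Dq root_minCpoly.
have sq : (0 < size q)%N by rewrite lt0n size_poly_eq0 monic_neq0.
pose f i := ratr q`_i * x ^+ i : algC.
have lt_n : ((size q).-1 < size q)%N by rewrite prednK.
have [||i [j [lt_ij fi0 fj0 Uij]]] := @sum0_valunit _ _ ringO valO (size q) f (Ordinal lt_n).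
- by rewrite /f /= -lead_coefE (monicP mon_q) rmorph1 mul1r expf_neq0.
- move: rq; rewrite /root horner_coef size_map_poly => /eqP e; rewrite -[RHS]e.
  by apply: eq_bigr => i _; rewrite coef_map.
have qi0 : q`_i != 0 by apply: contraNneq fi0; rewrite /f => ->; rewrite rmorph0 mul0r.
have qj0 : q`_j != 0 by apply: contraNneq fj0; rewrite /f => ->; rewrite rmorph0 mul0r.
have [ri Ui] := has_val_rat qi0; have [rj Uj] := has_val_rat qj0.
exists ((ri - rj)%:~R / (j - i)%N%:R); exists (j - i)%N; exists (ri - rj).
  by rewrite subn_gt0.
have -> : x ^+ (j - i) / P ^ (ri - rj) =
   f j / f i * ((ratr q`_i / P ^ ri) / (ratr q`_j / P ^ rj)).
  rewrite /f -[in X in _ * x ^+ X](subnK (ltnW lt_ij)) exprD expfzDr // -invr_expz.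
  by field; rewrite !expfz_neq0 //= !fmorph_eq0 qi0 qj0 expf_neq0.
by apply: valunitM => //; apply: valunitM => //; apply: valunitV.
Qed.

Lemma place_of_valring : inhabited (place p).
Proof.
have ex (x : algC) : exists q, x != 0 -> has_val x q.
  by have [->|/has_val_exists[q Hq]] := eqVneq x 0; [exists 0 | exists q].
pose v x := sval (cid (ex x)).
have vP x : x != 0 -> has_val x (v x) by rewrite /v; case: cid.
have O_v x : x != 0 -> (0 <= v x) <-> O x by move=> x0; apply/has_val_ge0/vP.
constructor.
refine (@Place p (valring_ring ringO) (residue_field ringO valO)
  resfield_pchar (valring_emb ringO) (residue_map ringO valO) v _ _ _ _ _ _).
- exact: valring_emb_inj.
- move=> x y x0 y0; apply: has_val_uniq (has_valM (vP x x0) (vP y y0)).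
  by apply: vP; rewrite mulf_neq0.
- by apply: has_val_uniq has_val_p; apply: vP.
- by move=> x x0 /(O_v x x0) Ox; apply: valring_embP.
- move=> t t0; apply/(O_v _ t0); exact: (@valringP _ O t).
- move=> t t0; have := has_valV (vP _ t0).
  have /has_val_ge0 H : (valring_emb ringO t)^-1 != 0 by rewrite invr_eq0.
  move=> /H; rewrite oppr_ge0 => vO.
  apply/eqP/idP; rewrite residue_map_eq0 // -vO ltNge; first by move/negP.
  by move/negP.
Qed.

End PlaceExists.

Theorem place_exists (p : nat) : prime p -> inhabited (place p).
Proof.
move=> p_pr; pose Z : set algC := [set x | exists z : int, x = z%:~R]%classic.
have ringZ : is_subring Z.
  split=> [|_ _ [x ->] [y ->]|_ _ [x ->] [y ->]]; first by exists 1.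
    by exists (x - y); rewrite intrB.
  by exists (x * y); rewrite intrM.
have p0 : p%:R != 0 :> algC by rewrite pnatr_eq0 -lt0n prime_gt0.
have Z'p : ~ Z p%:R^-1.
  move=> [z Dz]; have : (p%:Z * z) == 1.
    by rewrite -(eqr_int algC) intrM -Dz -pmulrn divff.
  by move/eqP/(congr1 absz); rewrite abszM /= => /eqP; rewrite muln_eq1 => /andP[/eqP p1]; rewrite p1 in p_pr.
have [O [sZO ringO O'p maxO]] := maximal_subring_avoiding ringZ Z'p.
apply: (@place_of_valring p p_pr O ringO _ O'p).
apply: (valuation_of_maximal ringO _ O'p maxO).
by rewrite invrK; apply: sZO; exists p%:Z; rewrite -pmulrn.
Qed.

(** * Newton polygons *)

Section Valuation.

Variables (p : nat) (p_prime : prime p) (pl : place p).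

Local Notation v := (pl_val pl).

(** These comparisons give 0 infinite valuation, whatever [pl_val] returns there. *)
Definition vge (x : algC) (r : rat) : bool := (x == 0) || (r <= v x).
Definition vgt (x : algC) (r : rat) : bool := (x == 0) || (r < v x).
Definition veq (x : algC) (r : rat) : bool := (x != 0) && (v x == r).

Lemma val1 : v 1 = 0.
Proof.
have := pl_valM pl (oner_neq0 algC) (oner_neq0 algC); rewrite mulr1.
by move/eqP; rewrite -subr_eq0 opprD addNKr oppr_eq0 => /eqP.
Qed.

Lemma valN x : x != 0 -> v (- x) = v x.
Proof.
have n1 : (-1 : algC) != 0 by rewrite oppr_eq0 oner_eq0.
have v1 : v (-1) = 0.
  have := pl_valM pl n1 n1; rewrite mulrNN mulr1 val1 => e; lra.
by move=> x0; rewrite -mulN1r pl_valM // v1 add0r.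
Qed.

Lemma valV x : x != 0 -> v x^-1 = - v x.
Proof.
move=> x0; have := pl_valM pl x0 (_ : x^-1 != 0).
rewrite invr_eq0 mulfV // val1 => /(_ x0) e; lra.
Qed.

Lemma valX x n : x != 0 -> v (x ^+ n) = n%:R * v x.
Proof.
move=> x0; elim: n => [|n IHn]; first by rewrite expr0 val1 mul0r.
by rewrite exprS pl_valM ?expf_neq0 // IHn -addn1 natrD mulrDl mul1r addrC.
Qed.

Lemma veqW x r : veq x r -> vge x r.
Proof. by move=> /andP[_ /eqP <-]; rewrite /vge lexx orbT. Qed.

Lemma vgtW x r : vgt x r -> vge x r.
Proof. by case/orP=> [|/ltW h]; rewrite /vge ?h ?orbT // => ->. Qed.

Lemma vge_trans r s x : r <= s -> vge x s -> vge x r.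
Proof. by move=> rs /orP[x0|/(le_trans rs) h]; rewrite /vge ?x0 ?h ?orbT. Qed.

Lemma vgt_trans r s x : r < s -> vge x s -> vgt x r.
Proof. by move=> rs /orP[x0|/(lt_le_trans rs) h]; rewrite /vgt ?x0 ?h ?orbT. Qed.

Lemma vgtWl r s x : r <= s -> vgt x s -> vgt x r.
Proof. by move=> rs /orP[x0|/(le_lt_trans rs) h]; rewrite /vgt ?x0 ?h ?orbT. Qed.

Lemma vge0 r : vge 0 r. Proof. by rewrite /vge eqxx. Qed.

Lemma vgt0 r : vgt 0 r. Proof. by rewrite /vgt eqxx. Qed.

Lemma veq1 : veq 1 0. Proof. by rewrite /veq oner_eq0 val1 eqxx. Qed.

Lemma vgtVveq x r : vge x r -> vgt x r || veq x r.
Proof.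
rewrite /vge /vgt /veq; case: (x == 0) => //=.
by rewrite le_eqVlt eq_sym => /orP[]->; rewrite ?orbT.
Qed.

Lemma vgt_veqF x r : vgt x r -> veq x r = false.
Proof.
rewrite /vgt /veq; case: eqP => //= _ h.
by rewrite gt_eqF.
Qed.

Lemma vge_emb t : vge (pl_emb pl t) 0.
Proof.
by rewrite /vge; case: eqP => //= /eqP t0; apply: pl_emb_ge0.
Qed.

Lemma vgeP x : reflect (exists t, pl_emb pl t = x) (vge x 0).
Proof.
apply: (iffP idP) => [|[t <-]]; last exact: vge_emb.
have [-> _|x0] := eqVneq x 0; first by exists 0; rewrite rmorph0.
by rewrite /vge (negPf x0) => /(pl_val_ge0 x0).
Qed.

Lemma red_eq0 t : (pl_red pl t == 0) = vgt (pl_emb pl t) 0.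
Proof.
rewrite /vgt; have [e|t0] := eqVneq (pl_emb pl t) 0; last exact: pl_red_eq0.
have -> : t = 0 by apply: (@pl_emb_inj _ pl); rewrite e rmorph0.
by rewrite rmorph0 eqxx.
Qed.

Lemma red_neq0 t : (pl_red pl t != 0) = veq (pl_emb pl t) 0.
Proof.
rewrite red_eq0; have /vgtVveq/orP[h|h] := vge_emb t.
  by rewrite h vgt_veqF.
by rewrite h; apply: contraL h => /vgt_veqF ->.
Qed.

Lemma vgeM x y r s : vge x r -> vge y s -> vge (x * y) (r + s).
Proof.
rewrite /vge mulf_eq0; case: eqP => //= /eqP x0; case: eqP => //= /eqP y0.
by rewrite pl_valM //; apply: lerD.
Qed.

Lemma vgtMl x y r s : vgt x r -> vge y s -> vgt (x * y) (r + s).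
Proof.
rewrite /vge /vgt mulf_eq0; case: eqP => //= /eqP x0; case: eqP => //= /eqP y0.
by rewrite pl_valM //; apply: ltr_leD.
Qed.

Lemma vgtMr x y r s : vge x r -> vgt y s -> vgt (x * y) (r + s).
Proof. by move=> xr ys; rewrite mulrC addrC; apply: vgtMl. Qed.

Lemma veqM x y r s : veq x r -> veq y s -> veq (x * y) (r + s).
Proof.
move=> /andP[x0 /eqP <-] /andP[y0 /eqP <-].
by rewrite /veq mulf_neq0 // pl_valM // eqxx.
Qed.

Lemma veqX x n r : veq x r -> veq (x ^+ n) (n%:R * r).
Proof. by move=> /andP[x0 /eqP <-]; rewrite /veq expf_neq0 // valX // eqxx. Qed.

Lemma vgeN x r : vge (- x) r = vge x r.
Proof. by rewrite /vge oppr_eq0; case: eqP => //= /eqP x0; rewrite valN. Qed.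

Lemma vgtN x r : vgt (- x) r = vgt x r.
Proof. by rewrite /vgt oppr_eq0; case: eqP => //= /eqP x0; rewrite valN. Qed.

Lemma veqN x r : veq (- x) r = veq x r.
Proof. by rewrite /veq oppr_eq0; case: eqP => //= /eqP x0; rewrite valN. Qed.

Lemma vgeD x y r : vge x r -> vge y r -> vge (x + y) r.
Proof.
wlog: x y / x == 0 \/ [&& x != 0, y != 0 & v x <= v y].
  move=> IH; have [->|x0] := eqVneq x 0; first by rewrite add0r.
  have [->|y0] := eqVneq y 0; first by rewrite addr0.
  have [le_xy|/ltW le_yx] := leP (v x) (v y); first by apply: IH; right; rewrite x0 y0.
  by move=> xr yr; rewrite addrC; apply: IH => //; right; rewrite x0 y0.
case=> [/eqP->|/and3P[x0 y0 le_xy]]; first by rewrite add0r.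
rewrite {1}/vge (negPf x0) /= => rx _; apply: vge_trans rx _.
have -> : x + y = x * (1 + y / x) by field.
rewrite -[v x]addr0; apply: vgeM; first by rewrite /vge lexx orbT.
have /vgeP[t Dt] : vge (y / x) 0.
  by rewrite /vge pl_valM ?invr_eq0 // valV // subr_ge0 le_xy orbT.
by apply/vgeP; exists (1 + t); rewrite rmorphD rmorph1 Dt.
Qed.

Lemma vgtP x r : vgt x r -> exists2 s, r < s & vge x s.
Proof.
rewrite /vgt; have [->|x0] /= := eqVneq x 0.
  by exists (r + 1); rewrite ?ltrDl // /vge eqxx.
by exists (v x); rewrite // /vge lexx orbT.
Qed.

Lemma vgtD x y r : vgt x r -> vgt y r -> vgt (x + y) r.
Proof.
move=> /vgtP[s rs xs] /vgtP[t rt yt].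
apply: (@vgt_trans _ (Num.min s t)); first by rewrite lt_min rs.
by apply: vgeD; [apply: vge_trans xs | apply: vge_trans yt]; rewrite ge_min lexx ?orbT.
Qed.

Lemma veqDl x y r : veq x r -> vgt y r -> veq (x + y) r.
Proof.
move=> xr yr; have /vgtVveq/orP[h|//] : vge (x + y) r.
  by apply: vgeD; [apply: veqW | apply: vgtW].
have : vgt x r by rewrite -[x](addrK y); apply: vgtD; rewrite ?vgtN.
by move/vgt_veqF; rewrite xr.
Qed.

Lemma veqDr x y r : vgt x r -> veq y r -> veq (x + y) r.
Proof. by move=> xr yr; rewrite addrC; apply: veqDl. Qed.

Lemma vge_sum (I : Type) (s : seq I) (P : pred I) (F : I -> algC) r :
  (forall i, P i -> vge (F i) r) -> vge (\sum_(i <- s | P i) F i) r.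
Proof. by move=> h; apply: (big_ind (fun x => vge x r)) => //; [exact: vge0 | move=> *; exact: vgeD]. Qed.

Lemma vgt_sum (I : Type) (s : seq I) (P : pred I) (F : I -> algC) r :
  (forall i, P i -> vgt (F i) r) -> vgt (\sum_(i <- s | P i) F i) r.
Proof. by move=> h; apply: (big_ind (fun x => vgt x r)) => //; [exact: vgt0 | move=> *; exact: vgtD]. Qed.

Lemma vge_int (z : int) : vge z%:~R 0.
Proof. by apply/vgeP; exists z%:~R; rewrite rmorph_int. Qed.

Lemma red_int_eq0 (z : int) : (pl_red pl z%:~R == 0) = (p %| `|z|)%N.
Proof.
rewrite rmorph_int (dvdn_pcharf (pl_pchar pl)).
by case: z => n /=; rewrite ?NegzE ?rmorphN ?oppr_eq0.
Qed.

Lemma veq_int (z : int) : z != 0 -> veq z%:~R (logn p `|z|%N)%:R.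
Proof.
move=> z0.
have [|m co_pm Dz] := @pfactor_coprime p `|z|%N p_prime; first by rewrite absz_gt0.
move: Dz; set l := logn p _; move=> Dz.
have -> : z = sgz z * m * (p ^ l)%N by rewrite {1}[z]intEsg {1}Dz PoszM mulrA.
rewrite intrM -pmulrn natrX -[X in veq _ X]add0r; apply: veqM.
  rewrite -(rmorph_int (pl_emb pl)) -red_neq0 red_int_eq0.
  by rewrite abszM absz_sg z0 mul1n -prime_coprime.
rewrite -[X in veq _ X]mulr1; apply: veqX.
by rewrite /veq pnatr_eq0 -lt0n prime_gt0 // pl_valp eqxx.
Qed.

Lemma veq_nat (n : nat) : (0 < n)%N -> veq n%:R (logn p n)%:R.
Proof.
by move=> n0; have := @veq_int n; rewrite eqz_nat -lt0n => /(_ n0); rewrite -pmulrn.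
Qed.

(** [W] is the minimum of [v (f_j) + j lam], so the line of slope [- lam] supporting the polygon has
    height [W] at 0; [n1] and [n2] are the first and last contact points. By induction: a factor
    [X - x] raises [W] by the minimum of [lam] and [v x]. *)
Lemma newton_roots (s : seq algC) (lam : rat) :
  let f := \prod_(x <- s) ('X - x%:P) in
  let n1 := count (fun x => vgt x lam) s in
  let n2 := count (fun x => vge x lam) s in
  exists W : rat,
  [/\ forall j, vge f`_j (W - j%:R * lam),
      veq f`_n1 (W - n1%:R * lam), veq f`_n2 (W - n2%:R * lam),
      forall j, (j < n1)%N -> vgt f`_j (W - j%:R * lam)
    & forall j, (n2 < j)%N -> vgt f`_j (W - j%:R * lam)].
Proof.
elim: s => [|x s] /=.
  exists 0; rewrite big_nil; split=> //; last first.
  - by move=> j j0; rewrite coef1 eqn0Ngt j0 vgt0.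
  - by rewrite coef1 /= mul0r subr0 veq1.
  - by rewrite coef1 /= mul0r subr0 veq1.
  - move=> j; rewrite coef1; case: eqP => [->|_]; last exact: vge0.
    by rewrite mul0r subr0 veqW ?veq1.
rewrite big_cons; set f := \prod_(y <- s) _.
set n1 := count _ s; set n2 := count _ s => -[W [geW eq1 eq2 gt1 gt2]].
pose T j := if j is i.+1 then f`_i else 0.
have coefE j : (('X - x%:P) * f)`_j = T j - x * f`_j.
  by rewrite mulrBl coefB coefXM coefCM; case: j.
have [gtx|ngtx] := boolP (vgt x lam).
  have gex := vgtW gtx; rewrite gex /= !add1n.
  exists (W + lam); have xf j : vgt (x * f`_j) (W + lam - j%:R * lam).
    have -> : W + lam - j%:R * lam = lam + (W - j%:R * lam) by ring.
    exact: vgtMl.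
  have ES j : W + lam - j.+1%:R * lam = W - j%:R * lam by rewrite -natr1; ring.
  split.
  - move=> j; rewrite coefE; apply: vgeD; last by rewrite vgeN vgtW.
    by case: j => [|j]; [apply: vge0 | rewrite ES; apply: geW].
  - by rewrite coefE; apply: veqDl; [rewrite ES | rewrite vgtN].
  - by rewrite coefE; apply: veqDl; rewrite ?vgtN // ES.
  - move=> j ltj; rewrite coefE; apply: vgtD; last by rewrite vgtN.
    by case: j ltj => [|j] ltj; [apply: vgt0 | rewrite ES; apply: gt1].
  - move=> [|j] // ltj; rewrite coefE; apply: vgtD; last by rewrite vgtN.
    by rewrite ES; apply: gt2.
have [gex|ngex] := boolP (vge x lam).
  have eqx : veq x lam by have := vgtVveq gex; rewrite (negPf ngtx).
  rewrite /= add0n add1n; exists (W + lam).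
  have ES j : W + lam - j.+1%:R * lam = W - j%:R * lam by rewrite -natr1; ring.
  have EM j : W + lam - j%:R * lam = lam + (W - j%:R * lam) by ring.
  split.
  - move=> j; rewrite coefE; apply: vgeD; first by case: j => [|j]; [apply: vge0 | rewrite ES; apply: geW].
    by rewrite vgeN EM; apply: vgeM.
  - rewrite coefE; apply: veqDr; last by rewrite veqN EM; apply: veqM.
    by case: n1 gt1 {eq1} => [|n] gt1; [apply: vgt0 | rewrite ES; apply: gt1].
  - rewrite coefE; apply: veqDl; rewrite ?ES // vgtN -ES EM; apply: vgtMr => //.
    exact: gt2.
  - move=> j ltj; rewrite coefE; apply: vgtD.
      by case: j ltj => [|j] ltj; [apply: vgt0 | rewrite ES; apply: gt1; apply: ltnW].
    by rewrite vgtN EM; apply: vgtMr => //; apply: gt1.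
  - move=> [|j] // ltj; rewrite coefE; apply: vgtD; first by rewrite ES; apply: gt2.
    by rewrite vgtN EM; apply: vgtMr => //; apply: gt2; apply: ltnW.
have [x0 ltx] : x != 0 /\ v x < lam.
  by move: ngex; rewrite /vge negb_or -ltNge => /andP.
have eqx : veq x (v x) by rewrite /veq x0 eqxx.
rewrite /= !add0n; exists (W + v x).
have EM j : W + v x - j%:R * lam = v x + (W - j%:R * lam) by ring.
have TM j : vgt (T j) (W + v x - j%:R * lam).
  case: j => [|j]; first exact: vgt0.
  by apply: (vgt_trans _ (geW j)); rewrite -natr1; lra.
split.
- move=> j; rewrite coefE; apply: vgeD; first exact/vgtW/TM.
  by rewrite vgeN EM; apply: vgeM => //; apply: veqW.
- by rewrite coefE; apply: veqDr => //; rewrite veqN EM; apply: veqM.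
- by rewrite coefE; apply: veqDr => //; rewrite veqN EM; apply: veqM.
- move=> j ltj; rewrite coefE; apply: vgtD => //.
  by rewrite vgtN EM; apply: vgtMr; [apply: veqW | apply: gt1].
- move=> j ltj; rewrite coefE; apply: vgtD => //.
  by rewrite vgtN EM; apply: vgtMr; [apply: veqW | apply: gt2].
Qed.

(* The segment of slope [- lam] of the Newton polygon joins the indices
   [j1 <= j2]. *)
Lemma newton_side (s : seq algC) (lam M : rat) (j1 j2 : nat) :
  let f := \prod_(x <- s) ('X - x%:P) in
  (forall j, vge f`_j (M - j%:R * lam)) ->
  veq f`_j1 (M - j1%:R * lam) -> veq f`_j2 (M - j2%:R * lam) ->
  (forall j, (j < j1)%N -> vgt f`_j (M - j%:R * lam)) ->
  (forall j, (j2 < j)%N -> vgt f`_j (M - j%:R * lam)) ->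
  count (fun x => vgt x lam) s = j1 /\ count (fun x => veq x lam) s = (j2 - j1)%N.
Proof.
move=> f geM e1 e2 g1 g2; have [W [geW e1' e2' g1' g2']] := newton_roots s lam.
rewrite -/f in geW e1' e2' g1' g2'.
set n1 := count (fun x => vgt x lam) s in e1' g1' *.
set n2 := count (fun x => vge x lam) s in e2' g2'.
have veq_vge x r r' : veq x r -> vge x r' -> r' <= r.
  by move=> /andP[x0 /eqP <-] /orP[/eqP e|//]; rewrite e eqxx in x0.
(* Both are the minimum of [v (f_j) + j lam], attained at [n1] for [W] and at [j1] for [M]. *)
have WM : W = M.
  have := veq_vge _ _ _ e1 (geW j1); have := veq_vge _ _ _ e1' (geM n1); lra.
rewrite WM in e1' e2' g1' g2'.
have not_lt x r : veq x r -> ~ vgt x r by move=> + /vgt_veqF => ->.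
have En1 : n1 = j1.
  apply/eqP; rewrite eqn_leq; apply/andP; split; rewrite leqNgt; apply/negP.
    by move/g1' => /not_lt; apply.
  by move/g1 => /not_lt; apply.
have En2 : n2 = j2.
  apply/eqP; rewrite eqn_leq; apply/andP; split; rewrite leqNgt; apply/negP.
    by move/g2 => /not_lt; apply.
  by move/g2' => /not_lt; apply.
split=> //; rewrite -En1 -En2 /n1 /n2; elim: (s) => //= x s' IH.
have -> : vge x lam = vgt x lam (+) veq x lam.
  have [gx|ngx] := boolP (vgt x lam); first by rewrite (vgt_veqF gx) vgtW.
  apply/idP/idP; last exact: veqW.
  by move/vgtVveq; rewrite (negPf ngx).
have := count_size (fun y => vgt y lam) s'.
have : (count (fun x => vgt x lam) s' <= count (fun x => vge x lam) s')%N.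
  by apply: sub_count => y; apply: vgtW.
have [gx|ngx] := boolP (vgt x lam); first by rewrite (vgt_veqF gx) /= IH; lia.
by rewrite IH; case: (veq x lam) => /=; lia.
Qed.

End Valuation.

(** * Valuations of binomial coefficients and convexity of the polygon *)

Lemma logn_bin_pfactor p k r : prime p -> (0 < r <= p ^ k)%N ->
  (logn p 'C(p ^ k, r) + logn p r = k + logn p 'C((p ^ k).-1, r.-1))%N.
Proof.
move=> p_pr; have pk0 : (0 < p ^ k)%N by rewrite expn_gt0 prime_gt0.
case: r => //= r ltr; rewrite -lognM ?bin_gt0 // mulnC -mul_bin_diag.
by rewrite lognM ?pfactorK // bin_gt0 -ltnS prednK.
Qed.

Lemma logn_lt p l r : prime p -> (0 < r < p ^ l)%N -> (logn p r < l)%N.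
Proof.
move=> p_pr /andP[r0 rl]; rewrite ltnNge; apply: contraL rl => lr.
by rewrite -leqNgt (leq_trans _ (dvdn_leq r0 (pfactor_dvdnn p r))) // leq_exp2l ?prime_gt1.
Qed.

(** By Pascal's rule two consecutive [C(p ^ k - 1, r)] add up to a multiple of [p], and the first
    one is 1. Consequently [C(p ^ k, r)] has valuation [k - v_p (r)], which puts the vertices of the
    polygon at [(p ^ l, k - l)]. *)
Lemma logn_bin_pfactor_pred p k r : prime p -> (r < p ^ k)%N ->
  logn p 'C((p ^ k).-1, r) = 0%N.
Proof.
move=> p_pr; have pk0 : (0 < p ^ k)%N by rewrite expn_gt0 prime_gt0.
elim: r => [|r IHr] ltr; first by rewrite bin0 logn1.
apply/eqP; rewrite -leqn0 leqNgt logn_gt0 mem_primes p_pr bin_gt0 -ltnS prednK //= ltr /=.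
have pN : ~~ (p %| 'C((p ^ k).-1, r))%N.
  apply: contra_eqN (IHr (ltnW ltr)) => pd; rewrite -lt0n logn_gt0 mem_primes p_pr pd.
  by rewrite bin_gt0 -ltnS prednK // ltnW.
apply: contra pN => pd; rewrite -(dvdn_addr _ pd) -binS prednK //.
have := @logn_bin_pfactor p k r.+1 p_pr; rewrite ltn0Sn (ltnW ltr) => /(_ isT).
have := @logn_lt p k r.+1 p_pr; rewrite ltr => /(_ isT) lt1 e.
have : (0 < logn p 'C(p ^ k, r.+1))%N by lia.
by rewrite logn_gt0 mem_primes => /and3P[].
Qed.

(** Convexity: with [t = l - j], the vertex [(p ^ l, k - l)] lies strictly above the line through
    the vertices for [j] and [j + 1]. *)
Lemma bernoulli_lt p t : (2 < p)%N -> (1 < t)%N -> (t * p.-1 + 1 < p ^ t)%N.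
Proof.
case: p => [|[|[|q]]] // _; case: t => [|[|t]] // _ /=.
by elim: t => [|t]; [rewrite -mulnn | rewrite !(expnS _ t.+2)]; nia.
Qed.

Lemma bernoulli_le p t : (2 < p)%N -> (t * p.-1 + 1 <= p ^ t)%N.
Proof.
move=> p2; case: t => [|[|t]] //; last exact/ltnW/bernoulli_lt.
by rewrite mul1n expn1 addn1 prednK // (ltn_trans _ p2).
Qed.

Lemma ndvdn_gt0 (p u : nat) : ~~ (p %| u)%N -> (0 < u)%N.
Proof. by case: u; rewrite ?dvdn0. Qed.

Section Sides.

Variables (p k V : nat).

(* The [l]-th segment of the polygon, from the left, as a set of roots: its
   length is [side_len l] and its slope [- 1 / side_len l], except that the
   leftmost one may be steeper when [V = k + 1]. *)
Definition side_len (l : nat) : nat :=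
  if l is l'.+1 then (p ^ (k.+1 - V + l') * p.-1)%N else (p ^ (k.+1 - V))%N.

Definition in_side (pl : place p) (l : nat) (x : algC) : bool :=
  if (l == 0%N) && (k < V)%N then vgt pl x p.-1%:R^-1
  else veq pl x (side_len l)%:R^-1.

End Sides.

(** * The Newton polygon of the trinomial expanded at a root of [x ^ u + a] *)

Section ShiftedTrinomial.

Variables (p : nat) (p_prime : prime p) (p_gt2 : (2 < p)%N) (pl : place p).
Variables (m u k : nat) (a b : int).
Hypotheses (pNa : ~~ (p %| `|a|)%N) (pNu : ~~ (p %| u)%N) .

Local Notation T := (pl_ring pl).
Local Notation emb := (pl_emb pl).

Variables (al : T) (V : nat).
Hypothesis alu : al ^+ u = (- a)%:~R.
Hypotheses (k_gt0 : (0 < k)%N) (V_gt0 : (0 < V)%N).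
Hypothesis V_le : (V <= k.+1)%N.
Hypothesis A_ge : vge pl (a + (- a) ^+ (p ^ k)%N)%:~R V%:R.
Hypothesis b_ge : vge pl b%:~R V%:R.

Definition shifted : {poly T} :=
  ('X + al%:P) ^+ m * (('X + al%:P) ^+ (u * p ^ k) + (a%:~R)%:P) + (b%:~R)%:P.

Local Notation f := (map_poly emb shifted).

Let h := 'X + al%:P : {poly T}.
(** The quotient of [h ^ u - al ^ u] by [h - al = X]. *)
Let g : {poly T} := \sum_(i < u) h ^+ (u.-1 - i) * al%:P ^+ i.

(** Since [h ^ u = - a + g X], the binomial formula applies to its power [p ^ k]; the term of index
    0 joins [a] to form [a + (- a) ^ (p ^ k)], of valuation at least [V]. *)
Lemma shifted_expand : shifted =
  (a + (- a) ^+ (p ^ k)%N)%:~R%:P * h ^+ m + (b%:~R)%:P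
  + \sum_(1 <= r < (p ^ k).+1)
     (('C(p ^ k, r)%:R * (- a)%:~R ^+ (p ^ k - r))%:P * (g ^+ r * h ^+ m)) * 'X^r.
Proof.
rewrite /shifted -/h.
have -> : h ^+ (u * p ^ k) = (((- a)%:~R)%:P + g * 'X) ^+ (p ^ k).
  rewrite exprM -alu rmorphXn /=; congr (_ ^+ _).
  have := subrXX h al%:P u; rewrite -/g {2}/h addrK mulrC => <-.
  by rewrite addrC subrK.
rewrite [(_ + g * 'X) ^+ _]exprDn big_ord_recl /= subn0 expr0 mulr1 bin0 mulr1n.
rewrite big_add1 /= big_mkord rmorphD rmorphXn /=.
set S := \sum_(i < _) _; set S' := \sum_(i < _) _.
suff -> : S' = S * h ^+ m by rewrite polyCD polyC_exp; ring.
rewrite /S /S' mulr_suml; apply: eq_bigr => i _.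
rewrite /bump /= add1n [(g * _) ^+ _]exprMn -[_ *+ _ in RHS]mulr_natl polyCM polyC_exp polyC_natr.
by ring.
Qed.

Lemma coef_shifted i : f`_i =
  (a + (- a) ^+ (p ^ k)%N)%:~R * emb (h ^+ m)`_i
  + (if i == 0%N then b%:~R else 0)
  + \sum_(1 <= r < (p ^ k).+1)
     (if (i < r)%N then 0 else emb ('C(p ^ k, r)%:R * (- a)%:~R ^+ (p ^ k - r) *
        (g ^+ r * h ^+ m)`_(i - r))).
Proof.
rewrite coef_map shifted_expand !coefD coefCM coefC coef_sum.
rewrite [LHS]rmorphD [X in X + _]rmorphD [X in X + _ + _]rmorphM rmorph_int.
rewrite rmorph_sum; congr (_ + _ + _); first by case: eqP; rewrite ?rmorph_int ?rmorph0.
apply: eq_bigr => r _; rewrite coefMXn coefCM.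
by case: ltnP => _; rewrite ?rmorph0.
Qed.

Lemma vge_shifted_term i r : (0 < r <= p ^ k)%N ->
  vge pl (emb ('C(p ^ k, r)%:R * (- a)%:~R ^+ (p ^ k - r) * (g ^+ r * h ^+ m)`_(i - r)))
    (k%:R - (logn p r)%:R).
Proof.
move=> rk; rewrite -mulrA rmorphM rmorph_nat -[X in vge _ _ X]addr0.
apply: vgeM; last exact: vge_emb.
have [r0 ler] := andP rk.
apply: (@vge_trans _ _ _ (logn p 'C(p ^ k, r))%:R); last first.
  by apply/veqW/veq_nat; rewrite ?bin_gt0.
rewrite lerBlDr -natrD ler_nat (logn_bin_pfactor p_prime rk).
exact: leq_addr.
Qed.

(** Only the terms of index [s <= i < p ^ j] reach the coefficient [i]; they have
    [v_p (s) <= j - 1], so their binomials have valuation at least [k - j + 1]. *)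
Lemma vge_shifted i j (r : rat) : (i < p ^ j)%N -> r <= V%:R ->
  r <= k%:R - j%:R + 1 -> vge pl f`_i r.
Proof.
move=> ltij rV rkj; rewrite coef_shifted; apply: vgeD; first apply: vgeD.
- apply: (vge_trans rV); rewrite -[X in vge _ _ X]addr0.
  by apply: vgeM; last exact: vge_emb.
- by case: eqP => _; rewrite ?vge0 //; apply: vge_trans b_ge.
rewrite big_nat_cond; apply: vge_sum => s; rewrite andbT ltnS => sk.
case: ltnP => [_|les]; first exact: vge0.
apply: (vge_trans _ (vge_shifted_term _ sk)); apply: (le_trans rkj).
have lt_sj : (logn p s < j)%N.
  by apply: logn_lt; rewrite // (leq_ltn_trans les ltij) andbT; case/andP: sk.
have : ((logn p s).+1%:R <= j%:R :> rat) by rewrite ler_nat.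
by rewrite -natr1; lra.
Qed.

Lemma veq_al : veq pl (emb al) 0.
Proof.
rewrite -red_neq0; have : pl_red pl al ^+ u != 0.
  by rewrite -rmorphXn /= alu red_int_eq0 // abszN.
by rewrite expf_eq0 negb_and; case/orP => //; rewrite -eqn0Ngt => /eqP u0; move: pNu; rewrite u0 dvdn0.
Qed.

(** The term of index [p ^ l] alone has the least valuation: earlier ones have [v_p (r) < l], and
    [k < V + l] keeps [k - l] below [V]. Its cofactor [(u al ^ (u - 1)) ^ (p ^ l) al ^ m] is a unit
    because [p] divides neither [u] nor [a]. *)
Lemma veq_shifted l : (l <= k)%N -> (k < V + l)%N ->
  veq pl f`_(p ^ l) (k%:R - l%:R).
Proof.
move=> lk kVl; have pl0 : (0 < p ^ l)%N by rewrite expn_gt0 prime_gt0.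
have plk : (p ^ l <= p ^ k)%N by rewrite leq_exp2l ?prime_gt1.
rewrite coef_shifted eqn0Ngt pl0 addr0; apply: veqDr.
  apply: (@vgt_trans _ _ _ (V%:R + 0)); last first.
    by apply: vgeM => //; apply: vge_emb.
  by rewrite addr0 ltrBlDr -natrD ltr_nat.
rewrite (bigD1_seq (p ^ l)%N) ?iota_uniq //=; last by rewrite mem_index_iota pl0.
rewrite ltnn subnn; apply: veqDl; last first.
  rewrite big_seq_cond; apply: vgt_sum => s.
  rewrite mem_index_iota ltnS => /andP[sk sNl].
  case: ltnP => [_|les]; first exact: vgt0.
  apply: (vgt_trans _ (vge_shifted_term _ sk)).
  rewrite ltrD2l ltrN2 ltr_nat; apply: logn_lt => //.
  by rewrite [(s < _)%N]ltn_neqAle sNl les; case/andP: sk => ->.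
have -> : (g ^+ (p ^ l) * h ^+ m)`_0 = (u%:R * al ^+ u.-1) ^+ (p ^ l) * al ^+ m.
  rewrite -horner_coef0 !(hornerM, horner_exp, hornerD, hornerX, hornerC) add0r.
  congr (_ ^+ _ * _); rewrite /g horner_sum.
  rewrite (eq_bigr (fun=> al ^+ u.-1)) ?sumr_const ?card_ord ?mulr_natl // => i _.
  rewrite !(hornerM, horner_exp, hornerD, hornerX, hornerC) add0r -exprD subnK //.
  by have := ltn_ord i; lia.
rewrite !rmorphM rmorph_nat !rmorphXn rmorphM !rmorphXn !rmorph_nat rmorph_int /=.
have unit_int z : ~~ (p %| `|z|)%N -> veq pl z%:~R 0.
  by move=> pNz; rewrite -(rmorph_int emb) -red_neq0 red_int_eq0.
have ua : veq pl (- a)%:~R 0 by apply: unit_int; rewrite abszN.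
have uu : veq pl u%:R 0 by rewrite (unit_int u%:Z).
have E : (k%:R - l%:R : rat) = (logn p 'C(p ^ k, p ^ l))%:R.
  have := @logn_bin_pfactor p k (p ^ l) p_prime; rewrite pl0 plk => /(_ isT).
  rewrite pfactorK // logn_bin_pfactor_pred //; last by rewrite prednK.
  by move/(congr1 (fun n => n%:R : rat)); rewrite /= addn0 natrD => <-; rewrite addrK.
have unitX x n : veq pl x 0 -> veq pl (x ^+ n) 0.
  by move=> /(veqX n); rewrite mulr0.
have unitM x y : veq pl x 0 -> veq pl y 0 -> veq pl (x * y) 0.
  by move=> hx hy; have := veqM hx hy; rewrite addr0.
rewrite -mulrA E -[X in veq _ _ X]addr0; apply: veqM.
  by apply: veq_nat; rewrite ?bin_gt0.
have ual := veq_al.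
by apply: (unitM); [apply: (unitX) | apply: (unitM); apply: (unitX) => //; apply: (unitM) => //; apply: (unitX)].
Qed.

Lemma coef0_shifted : f`_0 = emb al ^+ m * (a + (- a) ^+ (p ^ k)%N)%:~R + b%:~R.
Proof.
rewrite coef_shifted big_nat_cond big1 ?addr0 /=; last first.
  by move=> r; rewrite andbT => /andP[-> _].
rewrite -horner_coef0 horner_exp hornerD hornerX hornerC add0r.
by rewrite rmorphXn mulrC.
Qed.

Hypothesis f0_eq : (V <= k)%N -> veq pl f`_0 V%:R.

(** A staircase under the polygon: [l] is the base-[p] logarithm of [i], capped at [k], where the
    bound becomes plain integrality. *)
Lemma shifted_lower j i : (j <= k)%N -> (k < V + j)%N -> (p ^ j <= i)%N ->
  exists l, [/\ (j <= l <= k)%N, (p ^ l <= i)%N,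
    vge pl f`_i (k%:R - l%:R) & (l < k)%N -> (i < p ^ l.+1)%N].
Proof.
move=> jk kVj ji; have i0 : (0 < i)%N by rewrite (leq_trans _ ji) // expn_gt0 prime_gt0.
have /andP[le_l lt_l] := trunc_log_bounds (prime_gt1 p_prime) i0.
have jl : (j <= trunc_log p i)%N.
  by rewrite -ltnS -(ltn_exp2l _ _ (prime_gt1 p_prime)) (leq_ltn_trans ji).
have [kl|lk] := leqP k (trunc_log p i).
  exists k; rewrite jk leqnn ltnn; split=> //.
    by rewrite (leq_trans _ le_l) // leq_exp2l ?prime_gt1.
  by rewrite coef_map subrr vge_emb.
exists (trunc_log p i); rewrite jl (ltnW lk); split=> //.
apply: (vge_shifted lt_l); last by rewrite -natr1; lra.
rewrite lerBlDr -natrD ler_nat.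
by apply: (leq_trans (ltnW kVj)); rewrite leq_add2l.
Qed.

Lemma count_inner_side (s : seq algC) j : f = \prod_(x <- s) ('X - x%:P) ->
    (j < k)%N -> (k < V + j)%N ->
  count (fun x => vgt pl x (p ^ j * p.-1)%N%:R^-1) s = (p ^ j)%N /\
  count (fun x => veq pl x (p ^ j * p.-1)%N%:R^-1) s = (p ^ j * p.-1)%N.
Proof.
move=> Df jk kVj; set E := (p ^ j * p.-1)%N; set lam : rat := E%:R^-1.
have p1 : (0 < p.-1)%N by rewrite -subn1 subn_gt0 ltnW.
have E0 : (0 < E)%N by rewrite muln_gt0 expn_gt0 prime_gt0.
have DE : (p ^ j.+1 = p ^ j + E)%N.
  by rewrite expnSr /E -mulnS prednK ?prime_gt0.
have E0' : (0 < E%:R :> rat) by rewrite ltr0n.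
have lam0 : 0 < lam by rewrite invr_gt0.
have lamE : E%:R * lam = 1 by rewrite divff // gt_eqF.
(* Height at index 0 of the line through [(p ^ j, k - j)] and [(p ^ j.+1, k - j.+1)]. *)
pose M := k%:R - j%:R + (p ^ j)%N%:R * lam.
have below l i : (l * E + p ^ j <= i + j * E)%N -> M - i%:R * lam <= k%:R - l%:R.
  rewrite -(ler_nat rat) !natrD (natrM _ l) (natrM _ j) => hi.
  have := ler_wpM2r (ltW lam0) hi; rewrite !mulrDl -!mulrA lamE !mulr1 /M; lra.
have below_lt l i : (l * E + p ^ j < i + j * E)%N -> M - i%:R * lam < k%:R - l%:R.
  rewrite -(ltr_nat rat) !natrD (natrM _ l) (natrM _ j) => hi.
  have : (l%:R * E%:R + (p ^ j)%N%:R) * lam < (i%:R + j%:R * E%:R) * lam :> rat.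
    by rewrite ltr_pM2r.
  rewrite !mulrDl -!mulrA lamE !mulr1 /M; lra.
have Mj : M - (p ^ j)%N%:R * lam = k%:R - j%:R by rewrite /M; ring.
have MSj : M - (p ^ j.+1)%N%:R * lam = k%:R - j.+1%:R.
  by rewrite DE natrD /M mulrDl lamE -natr1; ring.
have kVj' : (k%:R + 1 <= V%:R + j%:R :> rat) by rewrite natr1 -natrD ler_nat.
(* To the left of [p ^ j] the coefficients have valuation at least [k - j + 1], while the line stays
   below that height because [p ^ j lam = 1 / (p - 1) < 1]. *)
have small i : (i < p ^ j)%N -> vgt pl f`_i (M - i%:R * lam).
  move=> ij; apply: (@vgt_trans _ _ _ (k%:R - j%:R + 1)); last first.
    by apply: vge_shifted ij _ _; lra.
  have : (p ^ j)%N%:R * lam < 1.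
    rewrite -[ltRHS]lamE ltr_pM2r // ltr_nat /E -[X in (X < _)%N]muln1.
    by rewrite ltn_pmul2l ?expn_gt0 ?prime_gt0 // -subn1 ltn_subRL.
  have : 0 <= i%:R * lam by rewrite mulr_ge0 ?ler0n // ltW.
  rewrite /M; lra.
have expand l : (j <= l)%N -> (l * E + p ^ j = p ^ j * ((l - j) * p.-1 + 1) + j * E)%N.
  by move=> jl; rewrite -{1}(subnK jl) /E; ring.
have pjl l : (j <= l)%N -> (p ^ l = p ^ j * p ^ (l - j))%N.
  by move=> jl; rewrite -expnD subnKC.
have := @newton_side p p_prime pl s lam M (p ^ j) (p ^ j.+1).
rewrite -Df Mj MSj DE addKn; apply.
- move=> i; have [ij|ji] := ltnP i (p ^ j)%N; first exact/vgtW/small.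
  have [|l [/andP[jl lk] pli ge_l _]] := shifted_lower _ kVj ji; first exact: ltnW.
  apply: vge_trans ge_l; apply: below.
  rewrite expand // leq_add2r (leq_trans _ pli) // (pjl l) //.
  by rewrite leq_mul2l bernoulli_le ?orbT.
- by apply: veq_shifted => //; apply: ltnW.
- by rewrite -DE; apply: veq_shifted; rewrite // addnS ltnW.
- exact: small.
- rewrite -DE => i ltji; have ji : (p ^ j <= i)%N.
    by rewrite (leq_trans _ (ltnW ltji)) // leq_exp2l ?prime_gt1.
  have [|l [/andP[jl lk] pli ge_l up]] := shifted_lower _ kVj ji; first exact: ltnW.
  apply: vgt_trans ge_l; apply: below_lt.
  rewrite expand // ltn_add2r.
  have [lt1|] := ltnP 1 (l - j)%N.
    rewrite (leq_trans _ pli) // (pjl l) // ltn_pmul2l ?expn_gt0 ?prime_gt0 //.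
    exact: bernoulli_lt.
  rewrite leq_eqVlt ltnS leqn0 => /orP[/eqP l1|/eqP l0].
    by rewrite l1 mul1n addn1 prednK ?prime_gt0 // -expnSr.
  have lj : l = j by lia.
  by move: (up); rewrite lj => /(_ jk); rewrite ltnNge ltnW.
Qed.

(** The segment from [(0, V)], a vertex by [f0_eq], to [(p ^ j, V - 1)], where [j = k + 1 - V] is
    the first exponent with [k - j < V]. *)
Lemma count_first_side (s : seq algC) : f = \prod_(x <- s) ('X - x%:P) ->
    (V <= k)%N ->
  count (fun x => veq pl x (p ^ (k.+1 - V))%N%:R^-1) s = (p ^ (k.+1 - V))%N.
Proof.
move=> Df Vk; set j := (k.+1 - V)%N; set E := (p ^ j)%N; set lam : rat := E%:R^-1.
have E0 : (0 < E)%N by rewrite expn_gt0 prime_gt0.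
have E0' : (0 < E%:R :> rat) by rewrite ltr0n.
have lam0 : 0 < lam by rewrite invr_gt0.
have lamE : E%:R * lam = 1 by rewrite divff // gt_eqF.
have Vj : (V + j = k.+1)%N by rewrite subnKC // ltnW.
have Vj' : (V%:R + j%:R = k%:R + 1 :> rat) by rewrite natr1 -natrD Vj.
have jk : (j <= k)%N by rewrite /j; lia.
have below l i : ((l - j).+1 * E <= i)%N -> (j <= l)%N -> V%:R - i%:R * lam <= k%:R - l%:R.
  rewrite -(ler_nat rat) natrM -natr1 => hi jl; rewrite natrB // in hi.
  have := ler_wpM2r (ltW lam0) hi; rewrite -mulrA lamE mulr1; lra.
have below_lt l i : ((l - j).+1 * E < i)%N -> (j <= l)%N -> V%:R - i%:R * lam < k%:R - l%:R.
  rewrite -(ltr_nat rat) natrM -natr1 => hi jl; rewrite natrB // in hi.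
  have : (l%:R - j%:R + 1) * E%:R * lam < i%:R * lam by rewrite ltr_pM2r.
  rewrite -mulrA lamE mulr1; lra.
have kVj : (k < V + j)%N by rewrite Vj.
have pjl l : (j <= l)%N -> (p ^ l = p ^ (l - j) * E)%N.
  by move=> jl; rewrite -expnD subnK.
have := @newton_side p p_prime pl s lam V%:R 0 E.
rewrite -Df mul0r subr0 subn0 lamE; case; last by move=> _ ->.
- move=> i; have [ij|ji] := ltnP i E.
    apply: (@vge_trans _ _ _ V%:R); last by apply: vge_shifted ij _ _; lra.
    have : 0 <= i%:R * lam by rewrite mulr_ge0 ?ler0n // ltW.
    lra.
  have [l [/andP[jl lk] pli ge_l _]] := shifted_lower jk kVj ji.
  apply: vge_trans ge_l; apply: below => //.
  rewrite (leq_trans _ pli) // (pjl l) // leq_mul2r ltn_expl ?orbT //; exact: prime_gt1.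
- exact: f0_eq.
- have -> : V%:R - 1 = k%:R - j%:R :> rat by lra.
  exact: veq_shifted.
- by [].
- move=> i ltEi; have [l [/andP[jl lk] pli ge_l up]] := shifted_lower jk kVj (ltnW ltEi).
  apply: vgt_trans ge_l; apply: below_lt => //.
  have [l0|l0] := posnP (l - j)%N; first by rewrite l0 mul1n.
  rewrite (leq_trans _ pli) // (pjl l) // ltn_pmul2r //.
  case: (l - j)%N l0 => // t _; elim: t => [|t]; first by rewrite expn1.
  by rewrite (expnS _ t.+1); nia.
Qed.

Lemma count_side (s : seq algC) l : f = \prod_(x <- s) ('X - x%:P) ->
  (l < V)%N -> count (in_side k V pl l) s = side_len p k V l.
Proof.
move=> Df; rewrite /in_side; case: l => [|l] /= lV.
  have [kV|Vk] := ltnP k V; last exact: count_first_side.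
  (* Now [f0_eq] says nothing about the constant coefficient. The first side is the single root
     steeper than the second side, counted by the first half of [count_inner_side] at [j = 0]. *)
  have DV : V = k.+1 by apply/eqP; rewrite eqn_leq V_le.
  have [|e _] := count_inner_side Df k_gt0; first by rewrite DV addn0.
  by move: e; rewrite DV subnn expn0 mul1n.
have [| |_ //] := @count_inner_side s (k.+1 - V + l) Df; lia.
Qed.

End ShiftedTrinomial.

(** * Recognizing a segment from a valuation *)

Section SideTheory.

Variables (p k V : nat) (p_gt2 : (2 < p)%N) (pl : place p).
Hypotheses (V_gt0 : (0 < V)%N) (V_le : (V <= k.+1)%N).

Lemma side_len_gt0 l : (0 < side_len p k V l)%N.
Proof.
have p0 : (0 < p)%N by apply: ltn_trans p_gt2.
case: l => [|l] /=; rewrite ?muln_gt0 expn_gt0 p0 //=.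
by rewrite -subn1 subn_gt0 ltnW.
Qed.

Lemma in_side_vgt0 l x : in_side k V pl l x -> vgt pl x 0.
Proof.
rewrite /in_side; case: ifP => _.
  by apply: vgtWl; rewrite invr_ge0 ler0n.
move/veqW; apply: vgt_trans.
by rewrite invr_gt0 ltr0n side_len_gt0.
Qed.

(** The segments have different slopes; for [V <= k] the lengths of the first two differ by the
    factor [p - 1], so [p > 2] is essential. *)
Lemma in_side_inj l l' x : in_side k V pl l x -> in_side k V pl l' x -> l = l'.
Proof.
wlog: l l' / (l <= l')%N.
  by move=> IH; case: (leqP l l') => [|/ltnW] h; [exact: IH | move=> *; apply/esym/IH].
case: l' => [|l']; first by rewrite leqn0 => /eqP.
move=> ll; rewrite {2}/in_side /= => inl /andP[x0 /eqP vx].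
have p0 : (0 < p)%N by apply: ltn_trans p_gt2.
have p1 : (0 < p.-1)%N by rewrite -subn1 subn_gt0 ltnW.
move: inl; rewrite /in_side; case: l ll => [|l] ll /=.
  case: ltnP => kV; rewrite /vgt /veq ?x0 ?(negPf x0) /= vx.
    have -> : (k.+1 - V = 0)%N by lia.
    rewrite ltf_pV2 ?posrE ?ltr0n ?muln_gt0 ?expn_gt0 ?p0 //= ltr_nat.
    by rewrite ltnNge leq_pmull // expn_gt0 p0.
  rewrite (inj_eq invr_inj) eqr_nat expnD -mulnA -[X in (_ == X)%N]muln1.
  rewrite eqn_pmul2l ?expn_gt0 ?p0 // muln_eq1 => /andP[_ /eqP]; lia.
rewrite /veq x0 vx /= (inj_eq invr_inj) eqr_nat eqn_pmul2r // eqn_exp2l ?(ltnW p_gt2) //.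
by rewrite eqn_add2l => /eqP->.
Qed.

(* A place of ramification index [e] above a point of a segment takes values
   in [1 / e Z], so that [e] is a multiple of the length of the segment. *)
Lemma side_len_le l x e s : in_side k V pl l x -> x != 0 -> (0 < e)%N ->
  pl_val pl x = s%:R / e%:R -> (side_len p k V l <= e)%N.
Proof.
move=> + x0 e0 vx; rewrite /in_side; case: ifP => [/andP[/eqP-> kV] _|_].
  by rewrite /=; have -> : (k.+1 - V = 0)%N by lia.
set E := side_len p k V l; have E0 : (0 < E)%N by apply: side_len_gt0.
rewrite /veq x0 vx /= -[E%:R^-1]mul1r eqr_div ?pnatr_eq0 -?lt0n // mul1r.
rewrite -natrM eqr_nat => /eqP De; move: e0; rewrite -De muln_gt0 => /andP[s0 _].
exact: leq_pmull.
Qed.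

Lemma in_side_unit l x y : veq pl y 0 -> in_side k V pl l (x * y) = in_side k V pl l x.
Proof.
move=> /andP[y0 /eqP vy]; rewrite /in_side /vgt /veq mulf_eq0 (negPf y0) orbF.
by case: (eqVneq x 0) => //= x0; rewrite pl_valM // vy addr0.
Qed.

End SideTheory.

(** * Conjugates in a monogenic field *)

Lemma irreducible_root_dvdp (F L : fieldType) (f : {rmorphism F -> L})
    (P q : {poly F}) (x : L) :
  irreducible_poly P -> root (map_poly f P) x ->
  root (map_poly f q) x = (P %| q).
Proof.
move=> [szP irrP] Px; apply/idP/idP => [/rootP qx|]; last first.
  by move=> /dvdpP[r ->]; rewrite rmorphM rootM Px orbT.
have [cop|ncop] := boolP (coprimep P q).
  have copf : coprimep (map_poly f P) (map_poly f q) by rewrite coprimep_map.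
  by have := coprimep_root copf Px; rewrite qx eqxx.
have /eqp_dvdl <- := irrP _ ncop (dvdp_gcdl P q).
exact: dvdp_gcdr.
Qed.

Lemma horner_map_comp (R S : comNzRingType) (f : {rmorphism R -> S}) p q x :
  (map_poly f (p \Po q)).[x] = (map_poly f p).[(map_poly f q).[x]].
Proof. by rewrite map_comp_poly horner_comp. Qed.

Lemma irreducible_rat_separable (P : {poly rat}) :
  irreducible_poly P -> separable_poly P.
Proof.
move=> [szP irrP]; rewrite unlock; apply/negPn/negP => ncop.
have /eqp_dvdl e := irrP _ ncop (dvdp_gcdl P P^`()).
have PdP : P %| P^`() by rewrite -e dvdp_gcdr.
have P0 : P != 0 by rewrite -size_poly_gt0 ltnW.
have dP0 : P^`() = 0.
  apply/eqP/negPn/negP => /dvdp_leq/(_ PdP).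
  by rewrite leqNgt lt_size_deriv.
have := congr1 (fun q : {poly rat} => q`_(size P).-2) dP0.
case: (size P) (lead_coefE P) szP => [|[|n]] //= Dlc _.
rewrite coef_deriv coef0 -Dlc => /eqP.
by rewrite mulrn_eq0 lead_coef_eq0 (negPf P0).
Qed.

Lemma map_poly_intr_in_alg (K : fieldExtType rat) (q : {poly int}) :
  map_poly intr q = map_poly (in_alg K) (map_poly intr q).
Proof.
rewrite -map_poly_comp; apply: eq_map_poly => z /=.
by rewrite -(rmorph_int (in_alg K)).
Qed.

Lemma map_poly_intr_ratr (q : {poly int}) :
  map_poly intr q = map_poly ratr (map_poly intr q) :> {poly algC}.
Proof. by rewrite -map_poly_comp; apply: eq_map_poly => z /=; rewrite ratr_int. Qed.

Section AlgebraicInteger.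

Variables (K : fieldExtType rat).

Lemma alg_int_horner (q : {poly int}) (x : K) :
  is_alg_int x -> is_alg_int (map_poly intr q).[x].
Proof.
move=> ix; apply: integral_horner ix; apply/integral_poly => i.
by rewrite coef_map; apply: integral_id.
Qed.

Lemma alg_int_quadratic (x b c : K) : is_alg_int b -> is_alg_int c ->
  x ^+ 2 + b * x + c = 0 -> is_alg_int x.
Proof.
move=> ib ic e; apply: (@integral_root_monic _ _ _ x ('X^2 + (b *: 'X + c%:P))).
- rewrite monicE lead_coefDl ?lead_coefXn // size_polyXn.
  rewrite (leq_ltn_trans (size_polyD _ _)) // gtn_max.
  rewrite (leq_ltn_trans (size_scale_leq _ _)) ?size_polyX //=.
  by rewrite (leq_ltn_trans (size_polyC_leq1 _)).
- by rewrite /root !hornerE; apply/eqP.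
- apply/integral_poly => i; rewrite !coefD coefXn coefZ coefX coefC.
  apply: integral_add; first exact: integral_nat.
  apply: integral_add; first by apply: integral_mul => //; apply: integral_nat.
  by case: eqP => _ //; apply: integral0.
Qed.

End AlgebraicInteger.

Lemma pred_addn_leq i j : (0 < i -> 0 < j -> (i + j).-1 <= i -> j = 1)%N.
Proof. by case: i j => // i [|[|j]] // _ _; rewrite addnS /= => h; lia. Qed.

Section Conjugates.

Variables (K : fieldExtType rat) (theta : K) (F : {poly int}).
Hypotheses (monF : F \is monic).
Hypothesis irrF : irreducible_poly (map_poly intr F : {poly rat}).
Hypothesis theta_root : root (map_poly intr F) theta.
Hypothesis theta_gen : <<1; theta>>%VS = fullv.

Local Notation rF := (map_poly intr F : {poly rat}).

Lemma gen_poly (x : K) : exists q : {poly rat}, x = (map_poly (in_alg K) q).[theta].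
Proof.
have : x \in <<1; theta>>%VS by rewrite theta_gen memvf.
by case/Fadjoin_polyP => _ /polyOver1P[q ->] ->; exists q.
Qed.

(* The last clause is Dedekind's criterion at [p], in the form in which it
   fails only if [Z[eta]] is not integrally closed. *)
Lemma monogenic_conjugates : monogenic K ->
  exists (g H : {poly int}) (etas : seq algC),
  [/\ g \is monic,
      map_poly intr g = \prod_(z <- etas) ('X - z%:P),
      map_poly intr F = \prod_(z <- etas) ('X - (map_poly intr H).[z]%:P)
    & forall (p e : nat) (G Q T T1 T2 : {poly int}), prime p ->
      G \is monic -> Q \is monic -> (1 < size G)%N ->
      g = G ^+ e.+2 * Q + p%:Z *: T -> T <> G * T1 + p%:Z *: T2].
Proof.
move=> [eta int_eta genO].
(* Identities in [K] reach [algC] as divisibility by [rF] in [Q[x]], which plays the role of the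
   embeddings of [K]. *)
have rFK q : root (map_poly (in_alg K) q) theta = (rF %| q).
  by apply: irreducible_root_dvdp => //; rewrite -map_poly_intr_in_alg.
have [J DJ] := gen_poly eta.
have [H DH] : exists H : {poly int}, theta = (map_poly intr H).[eta].
  apply: genO; apply: (@integral_root_monic _ _ _ theta (map_poly intr F)) => //.
    exact: monic_map.
  by apply/integral_poly => i; rewrite coef_map; apply: integral_id.
pose C : {poly rat} -> {poly algC} := map_poly ratr.
have [rts Dts] := closed_field_poly_normal (C rF).
have monrF : rF \is monic by apply: monic_map.
rewrite (monicP (monic_map _ monrF)) scale1r in Dts.
have rFC t q : t \in rts -> root (C q) t = (rF %| q).
  move=> tr; have rt : root (C rF) t by rewrite Dts root_prod_XsubC.
  exact: irreducible_root_dvdp rt.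
have uts : uniq rts.
  by rewrite -separable_prod_XsubC -Dts separable_map irreducible_rat_separable.
have [t1 t1P] : exists t1, t1 \in rts.
  case: rts Dts {rFC uts} => [|t1 ts] Dts; last by exists t1; rewrite inE eqxx.
  have := irrF.1; have <- : size (C rF) = size rF by rewrite size_map_poly.
  rewrite Dts big_nil.
  by rewrite size_poly1.
have HJ : rF %| (map_poly intr H \Po J) - 'X.
  rewrite -rFK /root rmorphB /= hornerD hornerN horner_map_comp -DJ.
  by rewrite -map_poly_intr_in_alg -DH map_polyX hornerX subrr.
(* The conjugates of [eta]. As [H] undoes [j] on the roots of [F], they are distinct, and they will
   be shown to be exactly the roots of [g]. *)
pose j t := (C J).[t].
have HjK t : t \in rts -> (map_poly intr H).[j t] = t.
  move=> /rFC e; move: HJ; rewrite -e /root /C rmorphB /= hornerD hornerN horner_map_comp.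
  by rewrite -map_poly_intr_ratr map_polyX hornerX subr_eq0 => /eqP.
have Aint1 : j t1 \in Aint.
  have [P monP Peta] := int_eta.
  apply: (@root_monic_Aint (map_poly intr P)).
  - have : rF %| (map_poly intr P \Po J).
      by rewrite -rFK /root horner_map_comp -map_poly_intr_in_alg -DJ.
    by rewrite -(rFC t1) // /root horner_map_comp -map_poly_intr_ratr.
  - exact: monic_map.
  - by apply/polyOverP => i; rewrite coef_map rpred_int.
have [g Dg] := Num.Theory.floorpP Aint1.
have [rg' [Drg monrg] rgP'] := minCpolyP (j t1).
set rg : {poly rat} := map_poly intr g.
have Erg : rg' = rg.
  by apply: (map_poly_inj (ratr : {rmorphism rat -> algC})); rewrite -Drg Dg map_poly_intr_ratr.
rewrite {}Erg in monrg rgP' {Drg}.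
have rgP q : root (C q) (j t1) = (rg %| q) by apply: rgP'.
have szrg : (1 < size rg)%N.
  have := size_minCpoly (j t1); rewrite Dg map_poly_intr_ratr.
  by rewrite (size_map_poly (ratr : {rmorphism rat -> algC})).
have rg0 : rg != 0 by rewrite -size_poly_gt0 ltnW.
have irrg : irreducible_poly rg.
  split=> // q szq /dvdpP[r Dr].
  have /orP[rr|rq] : root (C r) (j t1) || root (C q) (j t1).
  - by rewrite -rootM -rmorphM -Dr rgP.
  - move: rr; rewrite rgP => rgr; have r0 : r != 0 by apply: contraNneq rg0 => r0; rewrite Dr r0 mul0r.
    have q0 : q != 0 by apply: contraNneq rg0 => q0; rewrite Dr q0 mulr0.
    have := dvdp_leq r0 rgr; rewrite Dr size_mul // => le.
    have : (0 < size q)%N by rewrite size_poly_gt0.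
    have : (0 < size r)%N by rewrite size_poly_gt0.
    by move=> r_gt0 q_gt0; case/eqP: szq; apply: pred_addn_leq r_gt0 q_gt0 le.
  - by move: rq; rewrite rgP /eqp => ->; rewrite andbT Dr dvdp_mulIr.
have monig : g \is monic.
  move: monrg; rewrite !monicE lead_coef_map_inj //; last exact: intr_inj.
  by rewrite -[1]/(1%:~R) eqr_int.
have [zs Dzs] := closed_field_poly_normal (C rg).
rewrite (monicP (monic_map _ monrg)) scale1r in Dzs.
have uzs : uniq zs.
  by rewrite -separable_prod_XsubC -Dzs separable_map irreducible_rat_separable.
have rgC z q : z \in zs -> root (C q) z = (rg %| q).
  move=> zr; have rz : root (C rg) z by rewrite Dzs root_prod_XsubC.
  exact: irreducible_root_dvdp rz.
have rgJ : rF %| rg \Po J.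
  by rewrite -(rFC t1) // /root horner_map_comp -/(j t1) -[_ == _]/(root (C rg) (j t1)) rgP.
have FH : rg %| rF \Po map_poly intr H.
  rewrite -rgP /root horner_map_comp -!map_poly_intr_ratr HjK //.
  by rewrite map_poly_intr_ratr -[_ == _]/(root (C rF) t1) rFC.
have JH : rg %| (J \Po map_poly intr H) - 'X.
  rewrite -rgP /root /C rmorphB /= hornerD hornerN horner_map_comp -map_poly_intr_ratr.
  by rewrite HjK // map_polyX hornerX subrr.
have pzs : perm_eq [seq j t | t <- rts] zs.
  apply: uniq_perm => //.
    rewrite map_inj_in_uniq // => t t' tr tr' e.
    by rewrite -(HjK t) // e HjK.
  move=> z; apply/mapP/idP => [[t tr ->]|zr].
    rewrite -root_prod_XsubC -Dzs /root -horner_map_comp.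
    by move: rgJ; rewrite -(rFC t).
  exists (map_poly intr H).[z].
    rewrite -root_prod_XsubC -Dts /root.
    by move: FH; rewrite -(rgC z) // /root horner_map_comp -(map_poly_intr_ratr H).
  move: JH; rewrite -(rgC z) // /root /C rmorphB /= hornerD hornerN horner_map_comp.
  by rewrite -map_poly_intr_ratr map_polyX hornerX subr_eq0 => /eqP.
have rgK q : root (map_poly (in_alg K) q) eta -> rg %| q.
  rewrite DJ /root -horner_map_comp => h.
  by rewrite -rgP /root -horner_map_comp -[_ == _]/(root (C (q \Po J)) t1) rFC // -rFK.
have geta : (map_poly intr g).[eta] = 0.
  rewrite map_poly_intr_in_alg DJ -horner_map_comp; apply/eqP.
  by rewrite -[_ == _]/(root _ theta) rFK.
exists g, H, [seq j t | t <- rts]; split=> //.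
- by rewrite map_poly_intr_ratr -/(C rg) Dzs; apply/esym/perm_big.
- rewrite map_poly_intr_ratr -/(C rF) Dts big_map; apply: eq_big_seq => t tr.
  by rewrite HjK.
move=> p e G Q T T1 T2 p_pr monG monQ szG Dgp DT.
pose ev (q : {poly int}) : K := (map_poly intr q).[eta].
have evD q r : ev (q + r) = ev q + ev r by rewrite /ev rmorphD hornerD.
have evM q r : ev (q * r) = ev q * ev r by rewrite /ev rmorphM hornerM.
have evX q i : ev (q ^+ i) = ev q ^+ i by rewrite /ev rmorphXn horner_exp.
have evZ q : ev (p%:Z *: q) = p%:R * ev q.
  by rewrite /ev map_polyZ hornerZ.
have P0 : p%:R != 0 :> K.
  by rewrite -(rmorph_nat (in_alg K)) fmorph_eq0 pnatr_eq0 -lt0n prime_gt0.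
have E0 : ev G ^+ e.+2 * ev Q + p%:R * (ev G * ev T1 + p%:R * ev T2) = 0.
  by rewrite -geta -[RHS]/(ev g) Dgp evD evM evX evZ DT evD evM evZ.
(* If [T = G T1 + p T2], then [g (eta) = 0] makes [w] a root of the monic quadratic
   [w ^ 2 + T1 w + T2 Q G ^ e] over [Z[eta]]. So [w] is in [Z[eta]], hence [g] divides [Q G ^ e.+1]
   mod [p], and [G] would be invertible mod [p]. *)
pose w := ev (Q * G ^+ e.+1) / p%:R.
have [q Dq] : exists q, w = ev q.
  apply: genO; apply: (@alg_int_quadratic _ _ (ev T1) (ev (T2 * (Q * G ^+ e)))).
  - exact: alg_int_horner.
  - exact: alg_int_horner.
  have -> : w ^+ 2 + ev T1 * w + ev (T2 * (Q * G ^+ e)) =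
      ev Q * ev G ^+ e / p%:R ^+ 2 *
      (ev G ^+ e.+2 * ev Q + p%:R * (ev G * ev T1 + p%:R * ev T2)).
    by rewrite /w !evM !evX !exprS; field.
  by rewrite E0 mulr0.
have /dvdpP_int[r] : g %| Q * G ^+ e.+1 + p%:Z *: (- q).
  rewrite -dvdp_rat_int; apply: rgK.
  rewrite -map_poly_intr_in_alg /root -[_.[_]]/(ev _) evD evZ.
  have -> : ev (- q) = - ev q by rewrite /ev rmorphN hornerN.
  by rewrite -Dq /w mulrN mulrCA divff // mulr1 subrr.
rewrite (zprimitive_monic monig) => /(congr1 (map_poly (intr : int -> 'F_p))).
have [X DX] : exists X, X = G ^+ e.+1 by exists (G ^+ e.+1).
rewrite Dgp [G ^+ e.+2]exprS -DX.
rewrite !(rmorphD, rmorphM) /= !map_polyZ /=.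
have Ep : p%:Z%:~R = 0 :> 'F_p by rewrite -pmulrn (pcharf0 (pchar_Fp p_pr)).
rewrite !Ep !scale0r !addr0.
set G' := map_poly _ G; set Q' := map_poly _ Q; set r' := map_poly _ r.
set X' := map_poly _ X => e1.
have G'0 : G' != 0 by apply/monic_neq0/monic_map.
have Q'0 : Q' != 0 by apply/monic_neq0/monic_map.
have X'0 : X' != 0 by apply/monic_neq0/monic_map; rewrite DX monic_exp.
have : Q' * X' * (1 - G' * r') = 0 by rewrite mulrBr mulr1 {1}e1; ring.
move/eqP; rewrite !mulf_eq0 (negPf X'0) (negPf Q'0) /= subr_eq0.
move/eqP => e2.
have : size (G' * r') == 1%N by rewrite -e2 size_poly1.
rewrite size_mul_eq1 => /andP[+ _].
by rewrite size_map_poly_id0 ?(monicP monG) ?oner_eq0 // gtn_eqF.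
Qed.

End Conjugates.

(** * Places above a monogenic field *)

(** Each linear factor goes to exactly one of [A] and [B]. Roots are counted with multiplicity, so
    [A = G ^ e] yields [e deg G]. *)
Lemma count_root_split (L : fieldType) (A B : {poly L}) (rs : seq L) :
    A * B = \prod_(r <- rs) ('X - r%:P) ->
    (forall x, ~~ (root A x && root B x)) ->
  count (root A) rs = (size A).-1.
Proof.
elim: rs A B => [|r rs IH] A B.
  rewrite big_nil => AB1 _; have : size (A * B) == 1%N by rewrite AB1 size_poly1.
  by rewrite size_mul_eq1 => /andP[/eqP-> _].
rewrite big_cons => AB co; have P0 := monic_neq0 (monic_prod_XsubC rs xpredT id).
have X0 : 'X - r%:P != 0 by rewrite polyXsubC_eq0.
have AB0 : A * B != 0 by rewrite AB mulf_neq0.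
have : root (A * B) r by rewrite AB rootM root_XsubC eqxx.
rewrite rootM => /orP[Ar|Br]; last first.
  have nAr : ~~ root A r by apply: contra (co r) => ->; rewrite Br.
  rewrite /= (negPf nAr) add0n; have /factor_theorem[B' DB] := Br.
  apply: (IH A B').
    by apply: (mulIf X0); rewrite -mulrA -DB AB mulrC.
  by move=> x; apply: contra (co x) => /andP[-> B'x]; rewrite DB rootM B'x.
have nBr : ~~ root B r by apply: contra (co r) => ->; rewrite Ar.
rewrite /= Ar; have /factor_theorem[A' DA] := Ar.
have AB' : A' * B = \prod_(r <- rs) ('X - r%:P).
  by apply: (mulIf X0); rewrite mulrAC -DA AB mulrC.
have A'0 : A' != 0 by apply: contraNneq AB0 => A'0; rewrite DA A'0 !mul0r.
have szA' : (0 < size A')%N by rewrite size_poly_gt0.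
rewrite DA size_mul // size_XsubC addn2 /= -(prednK szA') add1n; congr _.+1.
rewrite -(IH A' B AB') => [|x]; last first.
  by apply: contra (co x) => /andP[A'x ->]; rewrite DA rootM A'x.
apply: eq_in_count => x xr; rewrite rootM root_XsubC.
have [e|_] := eqVneq x r; last by rewrite orbF.
rewrite orbT; apply/esym; have : root (A' * B) x by rewrite AB' root_prod_XsubC.
by rewrite rootM e (negPf nBr) orbF.
Qed.

Lemma Fp_morphism (p : nat) (L : fieldType) :
  p \in [pchar L] -> inhabited {rmorphism 'F_p -> L}.
Proof.
move=> chL; constructor.
exact: (GRing.in_alg (pPrimeCharType chL) : {rmorphism 'F_p -> pPrimeCharType chL}).
Qed.

Lemma exists_minpoly (F L : fieldType) (f : {rmorphism F -> L}) (P : {poly F}) x :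
    P != 0 -> root (map_poly f P) x ->
  exists G, [/\ G \is monic, irreducible_poly G & root (map_poly f G) x].
Proof.
move=> P0 Px.
pose Q n := `[< exists q : {poly F}, [/\ q != 0, size q = n & root (map_poly f q) x] >].
have exQ : exists n, Q n by exists (size P); apply/asboolP; exists P.
case: (ex_minnP exQ) => n /asboolP[G [G0 szG Gx]] minG.
have le q : q != 0 -> root (map_poly f q) x -> (size G <= size q)%N.
  by move=> q0 qx; rewrite szG; apply: minG; apply/asboolP; exists q.
have lc0 : lead_coef G != 0 by rewrite lead_coef_eq0.
have irrG : irreducible_poly G.
  split.
    rewrite ltnNge; apply/negP => /size1_polyC DG; move: Gx G0.
    by rewrite DG map_polyC /root hornerC fmorph_eq0 => /eqP->; rewrite eqxx.
  move=> q szq qG; have /dvdpP[r DG] := qG.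
  have r0 : r != 0 by apply: contraNneq G0 => r0; rewrite DG r0 mul0r.
  have q0 : q != 0 by apply: contraNneq G0 => q0; rewrite DG q0 mulr0.
  move: Gx; rewrite DG rmorphM rootM => /orP[/(le _ r0)|/(le _ q0) leGq].
    rewrite DG size_mul // => leGr; case/eqP: szq.
    by apply: pred_addn_leq leGr; rewrite size_poly_gt0.
  by rewrite -DG -(dvdp_size_eqp qG) eqn_leq leGq dvdp_leq.
exists ((lead_coef G)^-1 *: G); split.
- by rewrite monicE lead_coefZ mulVf.
- case: irrG => sG irrG; split; first by rewrite size_scale ?invr_eq0.
  move=> q szq; rewrite dvdpZr ?invr_eq0 // => /(irrG q szq) e.
  by rewrite (eqp_trans e) // eqp_sym eqp_scale ?invr_eq0.
- by rewrite map_polyZ /root hornerZ mulf_eq0 -[_.[x] == 0]/(root _ _) Gx orbT.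
Qed.

Lemma exists_multiplicity (F : fieldType) (G P : {poly F}) :
    P != 0 -> (1 < size G)%N ->
  exists e Q, P = G ^+ e * Q /\ ~~ (G %| Q).
Proof.
move=> P0 szG; have G0 : G != 0 by rewrite -size_poly_gt0 ltnW.
have ex : exists e, G ^+ e %| P by exists 0%N; rewrite expr0 dvd1p.
have bnd e : G ^+ e %| P -> (e <= size P)%N.
  move=> /(dvdp_leq P0); apply: leq_trans.
  case: (size G) (size_exp G e) szG => [|[|n]] //= + _.
  move=> h; rewrite -(prednK (_ : 0 < size (G ^+ e))%N) ?size_poly_gt0 ?expf_neq0 //.
  by rewrite h ltnW // ltnS leq_pmull.
case: (ex_maxnP ex bnd) => e /dvdpP[Q DP] maxe; exists e, Q.
rewrite mulrC; split=> //; apply/negP => /dvdpP[R DQ].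
have /maxe : G ^+ e.+1 %| P by rewrite DP DQ exprS -mulrA dvdp_mulIr.
by rewrite ltnn.
Qed.

(** The field generated by [H (x)] lies in that of [x]. In terms of cardinals: [r |-> r \Po H] mod
    [G] is injective on polynomials of degree less than [deg phi]. *)
Lemma leq_size_root_comp (p : nat) (L : fieldType) (f : {rmorphism 'F_p -> L})
    (phi G H : {poly 'F_p}) (x : L) :
    irreducible_poly phi -> irreducible_poly G ->
    root (map_poly f G) x -> root (map_poly f phi) (map_poly f H).[x] ->
  (size phi <= size G)%N.
Proof.
move=> irrphi irrG Gx phix; rewrite leqNgt; apply/negP => lt.
have [szphi _] := irrphi; have [szG _] := irrG.
set d := (size phi).-1; set D := (size G).-1.
have G0 : G != 0 by rewrite -size_poly_gt0 ltnW.
have szmod (r : {poly 'F_p}) : (size ((r \Po H) %% G)%R <= D)%N.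
  by rewrite -ltnS /D (prednK (ltnW szG)) ltn_modp.
pose h (r : 'rV['F_p]_d) : 'rV['F_p]_D := poly_rV ((rVpoly r \Po H) %% G).
have p_gt1 : (1 < #|'F_p|)%N by apply: finNzRing_gt1.
suff /leq_card : injective h.
  rewrite !card_mx !mul1n leq_exp2l // -ltnS (prednK (ltnW szphi)) (prednK (ltnW szG)).
  by rewrite leqNgt lt.
move=> r r' /(congr1 rVpoly); rewrite !poly_rV_K // => /eqP.
rewrite -subr_eq0 -modpN -modpD -rmorphN -raddfD /= => GH.
have : root (map_poly f (rVpoly r - rVpoly r')) (map_poly f H).[x].
  rewrite /root -horner_map_comp.
  by have := irreducible_root_dvdp (rVpoly r - rVpoly r' \Po H) irrG Gx; rewrite /dvdp GH /root => ->.
rewrite (irreducible_root_dvdp _ irrphi phix) => dv; apply/rowP => i.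
have [e|ne] := eqVneq (rVpoly r - rVpoly r') 0.
  by have := congr1 (fun q : {poly _} => q`_i) e; rewrite coefB coef0 !coef_rVpoly_ord => /eqP; rewrite subr_eq0 => /eqP.
have := dvdp_leq ne dv; rewrite leqNgt (leq_ltn_trans (size_polyD _ _)) //.
by rewrite size_polyN gtn_max -(prednK (ltnW szphi)) !ltnS !size_poly.
Qed.

(** * Lifting factorizations mod [p] to integer polynomials *)

Section Lifting.

Variables (p : nat) (p_prime : prime p).

Definition redp (q : {poly int}) : {poly 'F_p} := map_poly intr q.

Definition liftp (q : {poly 'F_p}) : {poly int} :=
  map_poly (fun x : 'F_p => (x : nat)%:Z) q.

Lemma Fp_int_eq0 (z : int) : ((z%:~R : 'F_p) == 0) = (p %| `|z|)%N.
Proof.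
rewrite (dvdn_pcharf (pchar_Fp p_prime)).
by case: z => n /=; rewrite ?NegzE ?rmorphN ?oppr_eq0.
Qed.

Lemma Fp_p_eq0 : p%:Z%:~R = 0 :> 'F_p.
Proof. by apply/eqP; rewrite Fp_int_eq0. Qed.

Lemma liftpK q : redp (liftp q) = q.
Proof.
apply/polyP => i; rewrite coef_map coef_map_id0 //=.
by rewrite -pmulrn natr_Zp.
Qed.

Lemma liftp_monic q : q \is monic -> liftp q \is monic.
Proof.
move=> monq; have sz : size (liftp q) = size q.
  by rewrite size_map_poly_id0 // (monicP monq).
by rewrite monicE lead_coefE sz coef_map_id0 // -lead_coefE (monicP monq).
Qed.

Lemma redp_eq0 q : redp q = 0 -> exists q', q = p%:Z *: q'.
Proof.
move=> q0; exists (map_poly (fun z => (z %/ p)%Z) q); apply/polyP => i.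
rewrite coefZ coef_map_id0 ?div0z // mulrC divzK //.
have := congr1 (fun r : {poly _} => r`_i) q0; rewrite coef_map coef0 => /eqP.
by rewrite /= Fp_int_eq0.
Qed.

(** For [e >= 2] the criterion itself forbids [G] to divide [T]. It is silent for [e = 1], but there
    the lift of [G] is free: adding [p] to it changes [T] into [T - Q], which [G] does not divide if
    it divides [T]. *)
Lemma dedekind_uniformizer (g : {poly int}) (G Q : {poly 'F_p}) e :
    (forall e (G Q T T1 T2 : {poly int}),
      G \is monic -> Q \is monic -> (1 < size G)%N ->
      g = G ^+ e.+2 * Q + p%:Z *: T -> T <> G * T1 + p%:Z *: T2) ->
    g \is monic -> (0 < e)%N -> G \is monic -> (1 < size G)%N ->
    redp g = G ^+ e * Q -> ~~ (G %| Q) ->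
  exists Gt Qt Tt, [/\ g = Gt ^+ e * Qt + p%:Z *: Tt, redp Gt = G,
    redp Qt = Q & ~~ (G %| redp Tt)].
Proof.
move=> ded mong e0 monG szG Dg GQ.
have monQ : Q \is monic.
  by rewrite -(monicMl _ (monic_exp e monG)) -Dg; apply: monic_map.
have [T DT] : exists T, g - liftp G ^+ e * liftp Q = p%:Z *: T.
  apply: redp_eq0; rewrite /redp rmorphB rmorphM rmorphXn /= -!/(redp _) !liftpK.
  by rewrite Dg subrr.
have {}Dg : g = liftp G ^+ e * liftp Q + p%:Z *: T by rewrite -DT addrC subrK.
have [GT|GT] := boolP (G %| redp T); last by exists (liftp G), (liftp Q), T; rewrite !liftpK.
case: e e0 Dg DT => [|[|e]] // _ Dg _; last first.
  have /dvdpP[R DR] := GT.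
  have [T2 DT2] : exists T2, T - liftp G * liftp R = p%:Z *: T2.
    apply: redp_eq0; rewrite /redp rmorphB rmorphM /= -!/(redp _) !liftpK DR.
    by rewrite mulrC subrr.
  have := ded e (liftp G) (liftp Q) T (liftp R) T2 (liftp_monic monG) (liftp_monic monQ).
  case=> //; last by rewrite -DT2 addrC subrK.
  by rewrite size_map_poly_id0 // (monicP monG).
exists (liftp G + p%:Z%:P), (liftp Q), (T - liftp Q); split; rewrite ?liftpK //.
- by rewrite {1}Dg !expr1 -!mul_polyC; ring.
- by rewrite /redp rmorphD /= map_polyC /= Fp_p_eq0 addr0 -/(redp _) liftpK.
- rewrite /redp rmorphB /= -!/(redp _) liftpK.
  by apply: contra GQ => h; rewrite -(dvdp_subr _ GT).
Qed.

End Lifting.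

(** * Valuations of integer polynomials at the conjugates of [eta] *)

Section Place.

Variables (p : nat) (p_prime : prime p) (pl : place p).
Variable f : {rmorphism 'F_p -> pl_res pl}.

Local Notation T := (pl_ring pl).
Local Notation emb := (pl_emb pl).
Local Notation red := (pl_red pl).

Definition evalp (q : {poly int}) (t : T) : T := (map_poly intr q).[t].

Lemma emb_evalp q t : emb (evalp q t) = (map_poly intr q).[emb t].
Proof.
rewrite -horner_map -map_poly_comp; congr (_.[_]); apply: eq_map_poly => z /=.
by rewrite rmorph_int.
Qed.

Lemma red_evalp q t : red (evalp q t) = (map_poly f (redp p q)).[red t].
Proof.
rewrite -horner_map /redp -!map_poly_comp; congr (_.[_]).
by apply: eq_map_poly => z /=; rewrite !rmorph_int.
Qed.

Lemma evalpD q r t : evalp (q + r) t = evalp q t + evalp r t.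
Proof. by rewrite /evalp rmorphD hornerD. Qed.

Lemma evalpB q r t : evalp (q - r) t = evalp q t - evalp r t.
Proof. by rewrite /evalp rmorphB hornerD hornerN. Qed.

Lemma evalpM q r t : evalp (q * r) t = evalp q t * evalp r t.
Proof. by rewrite /evalp rmorphM hornerM. Qed.

Lemma evalpX q n t : evalp (q ^+ n) t = evalp q t ^+ n.
Proof. by rewrite /evalp rmorphXn horner_exp. Qed.

Lemma evalpZ (c : int) q t : evalp (c *: q) t = c%:~R * evalp q t.
Proof. by rewrite /evalp map_polyZ hornerZ. Qed.

(* At [G (eta) = 0] mod [p], Dedekind's criterion makes [Gt (eta)] a uniformizer
   and [p] an [e]-th power of it, up to units. *)
Lemma val_uniform (g : {poly int}) (G : {poly 'F_p}) (es : seq T) e Gt Qt Tt h :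
    irreducible_poly G -> (0 < e)%N ->
    (forall t, t \in es -> evalp g t = 0) ->
    g = Gt ^+ e * Qt + p%:Z *: Tt -> redp p Gt = G -> ~~ (G %| redp p Qt) ->
    ~~ (G %| redp p Tt) ->
    (forall t, t \in es -> root (map_poly f G) (red t) -> emb (evalp h t) != 0) ->
  exists s : nat, forall t, t \in es -> root (map_poly f G) (red t) ->
    pl_val pl (emb (evalp h t)) = s%:R / e%:R.
Proof.
move=> irrG e0 g0 Dg DG GQ GT.
have [[t0 t0P Gt0]|no] := pselect (exists2 t, t \in es & root (map_poly f G) (red t)); last first.
  by move=> _; exists 0%N => t te Gt'; case: no; exists t.
have e0' : e%:R != 0 :> rat by rewrite pnatr_eq0 -lt0n.
have unit q t : ~~ (G %| redp p q) -> root (map_poly f G) (red t) ->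
    veq pl (emb (evalp q t)) 0.
  by move=> Gq Gt'; rewrite -red_neq0 red_evalp -[_ == 0]/(root _ _) (irreducible_root_dvdp _ irrG Gt').
have relE t : t \in es -> emb (evalp Gt t) ^+ e * emb (evalp Qt t) =
    - (p%:R * emb (evalp Tt t)).
  move=> /g0; rewrite Dg evalpD evalpM evalpX evalpZ => /(congr1 emb)/eqP.
  by rewrite rmorph0 rmorphD !rmorphM rmorphXn rmorph_int /= addr_eq0 => /eqP.
have p0 : p%:R != 0 :> algC by rewrite pnatr_eq0 -lt0n prime_gt0.
have valG t : t \in es -> root (map_poly f G) (red t) ->
    veq pl (emb (evalp Gt t)) (e%:R^-1).
  move=> te Gt'; have /andP[Q0 /eqP vQ] := unit _ _ GQ Gt'.
  have /andP[T0 /eqP vT] := unit _ _ GT Gt'.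
  have := relE t te; have [->|G0] := eqVneq (emb (evalp Gt t)) 0.
    rewrite expr0n eqn0Ngt e0 mul0r => /eqP; rewrite eq_sym oppr_eq0.
    by rewrite mulf_eq0 (negPf p0) (negPf T0).
  move=> /(congr1 (pl_val pl)); rewrite valN ?mulf_neq0 // !pl_valM ?expf_neq0 //.
  rewrite valX // vQ vT pl_valp !addr0 => ev.
  by rewrite /veq G0 /=; apply/eqP/(mulfI e0'); rewrite ev mulfV.
move=> h0; have [n] : exists n : nat, e%:R * pl_val pl (emb (evalp h t0)) < n%:R.
  by exists (Num.truncn (e%:R * pl_val pl (emb (evalp h t0)))).+1; apply: truncnS_gt.
(* Each round divides [h] by the uniformizer and lowers [e v (h (t0))] by 1. Divisibility by [G] is
   decided in [F_p[x]], so the number [s] of rounds is the same for all [t]. *)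
elim: n h h0 => [|n IHn] h h0 lt_n.
  by move: lt_n; rewrite ltNge mulr_ge0 ?ler0n // pl_emb_ge0 ?h0.
have [Gh|Gh] := boolP (G %| redp p h); last first.
  by exists 0%N => t te Gt'; have /andP[_ /eqP->] := unit _ _ Gh Gt'; rewrite mul0r.
have /dvdpP[R DR] := Gh.
have [h2 Dh2] : exists h2, h - Gt * liftp R = p%:Z *: h2.
  apply: (redp_eq0 p_prime).
  by rewrite /redp rmorphB rmorphM /= -!/(redp _ _) liftpK // DR DG mulrC subrr.
(* From [h = Gt R + p h2] and [p Tt = - Gt ^ e Qt] at [t]: the product [h Tt] equals [Gt h'] there,
   and [Tt] is a unit. *)
pose h' := liftp R * Tt - Gt ^+ e.-1 * Qt * h2.
have Dh' t : t \in es -> emb (evalp h t) * emb (evalp Tt t) =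
    emb (evalp Gt t) * emb (evalp h' t).
  move=> te; have -> : h = Gt * liftp R + p%:Z *: h2 by rewrite -Dh2 addrC subrK.
  rewrite /h' evalpD evalpM evalpZ evalpB !evalpM evalpX.
  rewrite rmorphB !(rmorphD, rmorphM, rmorphXn) /= rmorph_int -pmulrn.
  have := relE t te; rewrite -{1}(prednK e0) exprS => E0.
  set x := emb (evalp Gt t) in E0 *; set X := x ^+ e.-1 in E0 *.
  set y := emb (evalp Qt t) in E0 *; set z := emb (evalp Tt t) in E0 *.
  set r := emb (evalp (liftp R) t); set w := emb (evalp h2 t).
  have -> : x * (r * z - X * y * w) = x * r * z - x * X * y * w by ring.
  by rewrite E0; ring.
have h'0 t : t \in es -> root (map_poly f G) (red t) -> emb (evalp h' t) != 0 /\
    pl_val pl (emb (evalp h t)) = e%:R^-1 + pl_val pl (emb (evalp h' t)).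
  move=> te Gt'; have /andP[T0 /eqP vT] := unit _ _ GT Gt'.
  have /andP[G0 /eqP vG] := valG _ te Gt'.
  have ht := h0 t te Gt'; have := Dh' t te.
  have [->|h't] := eqVneq (emb (evalp h' t)) 0.
    by rewrite mulr0 => /eqP; rewrite mulf_eq0 (negPf ht) (negPf T0).
  by move=> /(congr1 (pl_val pl)); rewrite !pl_valM // vT addr0 vG.
have [||s vs] := IHn h'.
- by move=> t te Gt'; case: (h'0 t te Gt').
- have [_ v0] := h'0 t0 t0P Gt0; move: lt_n; rewrite v0 mulrDr divff // -natr1; lra.
exists s.+1 => t te Gt'; have [_ ->] := h'0 t te Gt'.
by rewrite vs // -natr1 mulrDl mul1r addrC.
Qed.

End Place.

(** * Roots of monic integer polynomials lie in the valuation ring *)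

Section Integrality.

Variables (p : nat) (pl : place p).

Local Notation T := (pl_ring pl).
Local Notation emb := (pl_emb pl).

(** At a [z] of negative valuation the leading term has strictly the least valuation, so the value
    cannot vanish. *)
Lemma monic_root_emb (P : {poly int}) (z : algC) :
  P \is monic -> root (map_poly intr P) z -> exists t, emb t = z.
Proof.
move=> monP Pz; apply/vgeP; rewrite /vge; have [//|z0] /= := eqVneq z 0.
rewrite leNgt; apply/negP => v_lt0.
have szP : size P = (size P).-1.+1 by rewrite prednK // size_poly_gt0 monic_neq0.
move: Pz; rewrite /root horner_coef size_map_poly_id0 ?(monicP monP) ?oner_eq0 //.
rewrite szP big_ord_recr /= coef_map -lead_coefE (monicP monP) mul1r.
set N := (size P).-1; set S := \sum_(i < N) _ => e.
have : veq pl (S + z ^+ N) (N%:R * pl_val pl z).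
  apply: veqDr; last by apply: veqX; rewrite /veq z0 eqxx.
  apply: vgt_sum => i _; rewrite coef_map.
  apply: (@vgt_trans _ _ _ (0 + i%:R * pl_val pl z)).
    by rewrite add0r ltr_nM2r // ltr_nat.
  apply: vgeM; first exact: vge_int.
  by apply/veqW/veqX; rewrite /veq z0 eqxx.
by rewrite /veq e.
Qed.

Lemma monic_roots_emb (P : {poly int}) (zs : seq algC) :
    P \is monic -> map_poly intr P = \prod_(z <- zs) ('X - z%:P) ->
  exists ts : seq T, zs = map emb ts.
Proof.
move=> monP DP.
have : forall z, z \in zs -> exists t, emb t = z.
  by move=> z zP; apply: (monic_root_emb monP); rewrite DP root_prod_XsubC.
elim: zs {DP} => [|z zs IH] h; first by exists [::].
have [ts ->] : exists ts, zs = map emb ts.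
  by apply: IH => x xs; apply: h; rewrite inE xs orbT.
by have [t <-] := h z (mem_head _ _); exists (t :: ts).
Qed.

Lemma map_emb_inj : injective (map_poly emb).
Proof.
move=> P Q e; apply/polyP => i; apply: (@pl_emb_inj _ pl).
by rewrite -!coef_map e.
Qed.

Lemma map_intr_emb (P : {poly int}) : map_poly emb (map_poly intr P) = map_poly intr P.
Proof. by rewrite -map_poly_comp; apply: eq_map_poly => z /=; rewrite rmorph_int. Qed.

Lemma prod_XsubC_emb (P : {poly int}) (I : Type) (s : seq I) (F : I -> T) :
    map_poly intr P = \prod_(i <- s) ('X - (emb (F i))%:P) ->
  map_poly intr P = \prod_(i <- s) ('X - (F i)%:P).
Proof.
move=> DP; apply: map_emb_inj; rewrite map_intr_emb DP rmorph_prod.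
by apply: eq_bigr => i _; rewrite rmorphB /= map_polyX map_polyC.
Qed.

End Integrality.

(** * Conjugates belonging to one factor [phi] and one segment *)

Section ClassCount.

Variables (p : nat) (p_prime : prime p) (p_gt2 : (2 < p)%N) (pl : place p).
Variable f : {rmorphism 'F_p -> pl_res pl}.

Local Notation T := (pl_ring pl).
Local Notation emb := (pl_emb pl).
Local Notation red := (pl_red pl).

Variables (m u k V : nat) (a b A1 b1 : int) (H : {poly int}) (es : seq T).

Local Notation theta := (evalp (pl := pl) H).

Hypotheses (pNa : ~~ (p %| `|a|)%N) (pNu : ~~ (p %| u)%N) (k_gt0 : (0 < k)%N).
Hypotheses (V_gt0 : (0 < V)%N) (V_le : (V <= k.+1)%N).
Hypothesis DA : a + (- a) ^+ (p ^ k)%N = (p ^ V)%N%:Z * A1.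
Hypothesis Db : b = (p ^ V)%N%:Z * b1.
Hypothesis DF : map_poly intr (trinomial (m + u * p ^ k) m a b) =
  \prod_(t <- es) ('X - (theta t)%:P).

Lemma veq_ppow : veq pl (p ^ V)%N%:Z%:~R V%:R.
Proof.
by rewrite -pmulrn -{2}(pfactorK V p_prime); apply: veq_nat; rewrite ?expn_gt0 ?prime_gt0.
Qed.

Lemma shifted_comp (al : T) :
  shifted m u k a b al = map_poly intr (trinomial (m + u * p ^ k) m a b) \Po ('X + al%:P).
Proof.
rewrite /shifted /trinomial !rmorphD /= map_polyZ map_polyC !map_polyXn /=.
rewrite /= linearZ /= !rmorphXn /= comp_polyX comp_polyC.
by rewrite mulrDr exprD -mul_polyC mulrC [_ * (_%:P)]mulrC.
Qed.

(** Its value at the reduction of [al] is that of the constant coefficient of [F (al + X)] divided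
    by [p ^ V]; when it is nonzero, the polygon starts exactly at height [V]. *)
Let c1 : {poly 'F_p} := A1%:~R *: 'X^m + b1%:~R%:P.

Lemma count_theta_side (al : T) (l : nat) : al ^+ u = (- a)%:~R ->
    ((V <= k)%N -> ~~ root (map_poly f c1) (red al)) -> (l < V)%N ->
  count (fun t => in_side k V pl l (emb (theta t - al))) es = side_len p k V l.
Proof.
move=> alu good lV.
rewrite -(count_map (fun t => emb (theta t - al)) (in_side k V pl l)).
have A_ge : vge pl (a + (- a) ^+ (p ^ k)%N)%:~R V%:R.
  rewrite DA intrM -[X in vge _ _ X]addr0; apply: vgeM; first exact/veqW/veq_ppow.
  exact: vge_int.
have b_ge : vge pl b%:~R V%:R.
  rewrite Db intrM -[X in vge _ _ X]addr0; apply: vgeM; first exact/veqW/veq_ppow.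
  exact: vge_int.
apply: (count_side (m := m) p_prime p_gt2 pNa pNu alu k_gt0 V_gt0 V_le A_ge b_ge _ _ lV).
  move=> Vk; rewrite coef0_shifted // DA Db !intrM.
  rewrite mulrCA -mulrDr -[X in veq _ _ X]addr0; apply: veqM; first exact: veq_ppow.
  rewrite -!(rmorph_int emb) -rmorphXn -rmorphM -rmorphD -red_neq0.
  suff -> : red (al ^+ m * A1%:~R + b1%:~R) = (map_poly f c1).[red al] by exact: good.
  rewrite /c1 [map_poly f _]rmorphD /= map_polyZ map_polyXn map_polyC /= !hornerE.
  by rewrite rmorphD rmorphM rmorphXn !rmorph_int mulrC.
rewrite shifted_comp DF rmorph_prod rmorph_prod big_map; apply: eq_bigr => t _.
rewrite /= rmorphB /= comp_polyX comp_polyC.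
have -> : 'X + al%:P - (theta t)%:P = 'X - (theta t - al)%:P by rewrite polyCB; ring.
by rewrite rmorphB /= map_polyX map_polyC.
Qed.

Lemma separable_XnaddC : separable_poly ('X^u + a%:~R%:P : {poly 'F_p}).
Proof.
have a0 : a%:~R != 0 :> 'F_p by rewrite Fp_int_eq0.
have u0 : u%:R != 0 :> 'F_p by rewrite -(dvdn_pcharf (pchar_Fp p_prime)).
rewrite unlock; apply/Bezout_coprimepP.
(* Bezout relation [(X ^ u + a) / a - X (u X ^ (u - 1)) / (u a) = 1]. *)
exists ((a%:~R^-1)%:P, - (u%:R * a%:~R)^-1 *: 'X) => /=.
rewrite derivD derivC addr0 derivXn -scalerAl mulrnAr -exprS (prednK (ndvdn_gt0 pNu)).
rewrite mulrDr -polyCM mulVf // mul_polyC -scaler_nat scalerA mulNr invfM mulrAC mulVf //.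
by rewrite mul1r scaleNr addrAC subrr add0r eqpxx.
Qed.

Lemma redp_XnaddC : redp p ('X^u + a%:P) = 'X^u + a%:~R%:P.
Proof. by rewrite /redp rmorphD /= map_polyXn map_polyC. Qed.

Lemma exists_al : exists als : seq T,
  map_poly intr ('X^u + a%:P : {poly int}) = \prod_(al <- als) ('X - al%:P).
Proof.
have monX : 'X^u + a%:P \is @monic int.
  by rewrite monicE lead_coefDl ?lead_coefXn // size_polyXn ltnS (leq_trans (size_polyC_leq1 _)) ?(ndvdn_gt0 pNu).
have [zs Dzs] := closed_field_poly_normal (map_poly intr ('X^u + a%:P) : {poly algC}).
rewrite (monicP (monic_map _ monX)) scale1r in Dzs.
have [als Dals] := monic_roots_emb pl monX Dzs.
by exists als; apply: prod_XsubC_emb; rewrite Dzs Dals big_map.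
Qed.

(** A conjugate counted here is close to exactly one root [al] of [X ^ u + a], and [theta ^ u + a]
    then differs from [theta - al] by a unit, the other roots having different reductions. It
    remains to sum over the [deg phi] roots [al] that reduce to roots of [phi]. *)
Lemma count_phi_side (phi : {poly 'F_p}) (l : nat) : irreducible_poly phi ->
    phi %| 'X^u + a%:~R%:P -> ((V <= k)%N -> ~~ (phi %| c1)) -> (l < V)%N ->
  count (fun t => root (map_poly f phi) (red (theta t)) &&
    in_side k V pl l (emb (theta t ^+ u + a%:~R))) es
  = ((size phi).-1 * side_len p k V l)%N.
Proof.
move=> irrphi phiX good lV; have [als Dals] := exists_al.
have DL : map_poly f ('X^u + a%:~R%:P) = \prod_(x <- map red als) ('X - x%:P).
  rewrite -redp_XnaddC /redp -map_poly_comp.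
  rewrite (eq_map_poly (g := red \o intr)) => [|z /=]; last by rewrite !rmorph_int.
  rewrite map_poly_comp Dals rmorph_prod big_map; apply: eq_bigr => x _.
  by rewrite rmorphB /= map_polyX map_polyC.
have uals : uniq (map red als).
  by rewrite -separable_prod_XsubC -DL separable_map separable_XnaddC.
have alE al : al \in als -> al ^+ u = (- a)%:~R.
  move=> alP; have : root (map_poly intr ('X^u + a%:P) : {poly T}) al.
    rewrite Dals /root horner_prod (perm_big _ (perm_to_rem alP)) big_cons /=.
    by rewrite !hornerE subrr mul0r.
  rewrite /root rmorphD /= map_polyXn map_polyC /= !hornerE addr_eq0 => /eqP ->.
  by rewrite rmorphN.
have yE t : theta t ^+ u + a%:~R = \prod_(al <- als) (theta t - al).
  have := congr1 (fun P : {poly T} => P.[theta t]) Dals.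
  rewrite rmorphD /= map_polyXn map_polyC /= !hornerE => ->.
  by rewrite horner_prod; apply: eq_bigr => x _; rewrite !hornerE.
have red_eq l' t al : in_side k V pl l' (emb (theta t - al)) -> red (theta t) = red al.
  move/(in_side_vgt0 p_gt2); rewrite -red_eq0 rmorphB subr_eq0.
  by move/eqP.
have unit_y l' t al : al \in als -> red (theta t) = red al ->
    in_side k V pl l' (emb (theta t ^+ u + a%:~R)) =
    in_side k V pl l' (emb (theta t - al)).
  move=> alP e; rewrite yE (perm_big _ (perm_to_rem alP)) big_cons /= rmorphM.
  apply: in_side_unit; rewrite -red_neq0 rmorph_prod.
  rewrite prodf_seq_neq0; apply/allP => x xr /=; rewrite rmorphB subr_eq0 e.
  have := uals; rewrite (perm_uniq (perm_map red (perm_to_rem alP))) /= => /andP[+ _].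
  by apply: contraNneq => ->; apply: map_f.
rewrite -sum1_count big_mkcond /=.
transitivity (\sum_(t <- es) \sum_(al <- als | root (map_poly f phi) (red al))
   (in_side k V pl l (emb (theta t - al)) : nat)).
  apply: eq_big_seq => t te.
  have [[al0 al0P /andP[phi0 in0]]|no] := pselect (exists2 al0, al0 \in als &
      root (map_poly f phi) (red al0) && in_side k V pl l (emb (theta t - al0))).
    have e0 := red_eq _ _ _ in0.
    rewrite e0 phi0 (unit_y _ _ _ al0P e0) in0 /=.
    rewrite (big_rem al0) //= phi0 in0 big_seq_cond big1 ?addn0 // => x /andP[xr _].
    case: (boolP (in_side _ _ _ _ _)) => // /red_eq ex.
    have := uals; rewrite (perm_uniq (perm_map red (perm_to_rem al0P))) /= => /andP[+ _].
    by rewrite -e0 ex map_f.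
  rewrite big_seq_cond [RHS]big1 => [|x /andP[xr phix]]; last first.
    by case: (boolP (in_side _ _ _ _ _)) => // inx; case: no; exists x; rewrite ?phix.
  case: ifP => // /andP[phit iny]; case: no.
  have : root (map_poly f ('X^u + a%:~R%:P)) (red (theta t)).
    by rewrite (irreducible_root_dvdp _ irrphi phit).
  rewrite DL root_prod_XsubC => /mapP[al alP e]; exists al => //.
  by rewrite -e phit -(unit_y _ _ _ alP e).
rewrite exchange_big /= big_seq_cond.
rewrite (eq_bigr (fun=> side_len p k V l)) => [|al /andP[alP phial]]; last first.
  rewrite -(@count_theta_side al l) ?alE // => [|Vk].
    by rewrite -sum1_count [RHS]big_mkcond; apply: eq_bigr => t _; case: ifP.
  by rewrite (irreducible_root_dvdp _ irrphi phial) good.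
rewrite -big_seq_cond big_const_seq iter_addn_0 mulnC; congr (_ * _)%N.
rewrite -(count_map red (root (map_poly f phi))).
have /dvdpP[B DB] := phiX.
rewrite (@count_root_split _ (map_poly f phi) (map_poly f B)) ?size_map_poly //.
  by rewrite -rmorphM mulrC -DB.
move=> x; apply/negP => /andP[phix Bx].
have sep := separable_XnaddC; rewrite DB separable_mul in sep.
have /and3P[_ _ co] := sep.
have := coprimep_root (_ : coprimep (map_poly f phi) (map_poly f B)) phix.
by rewrite coprimep_map coprimep_sym => /(_ co); rewrite (rootP Bx) eqxx.
Qed.

Lemma in_side_val l x y : x != 0 -> y != 0 -> pl_val pl x = pl_val pl y ->
  in_side k V pl l x = in_side k V pl l y.
Proof. by move=> x0 y0 e; rewrite /in_side /vgt /veq x0 y0 (negPf x0) (negPf y0) e. Qed.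

Lemma leq_of_mul_bounds e D d sl : (0 < e -> sl <= e -> e * D <= d * sl -> D <= d)%N.
Proof.
move=> e0 le h; rewrite -(leq_pmul2l e0) (leq_trans h) // mulnC.
by rewrite leq_mul2r le orbT.
Qed.

Variable g : {poly int}.
Hypothesis mong : g \is monic.
Hypothesis Dg : map_poly intr g = \prod_(t <- es) ('X - t%:P).
Hypothesis ded : forall e (G Q T T1 T2 : {poly int}),
  G \is monic -> Q \is monic -> (1 < size G)%N ->
  g = G ^+ e.+2 * Q + p%:Z *: T -> T <> G * T1 + p%:Z *: T2.
Hypothesis y_neq0 : forall t, t \in es -> emb (theta t ^+ u + a%:~R) != 0.

Lemma side_prime (phi : {poly 'F_p}) (l : nat) : irreducible_poly phi ->
    phi %| 'X^u + a%:~R%:P -> ((V <= k)%N -> ~~ (phi %| c1)) -> (l < V)%N ->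
  exists G : {poly 'F_p}, [/\ G \is monic, irreducible_poly G, size G = size phi,
    exists2 t, t \in es & root (map_poly f G) (red t)
    & forall t, t \in es -> root (map_poly f G) (red t) ->
        root (map_poly f phi) (red (theta t)) &&
        in_side k V pl l (emb (theta t ^+ u + a%:~R))].
Proof.
move=> irrphi phiX good lV.
have cE := count_phi_side irrphi phiX good lV.
have [szphi _] := irrphi.
have /hasP[t0 t0P /andP[phi0 in0]] : has (fun t => root (map_poly f phi) (red (theta t)) &&
    in_side k V pl l (emb (theta t ^+ u + a%:~R))) es.
  by rewrite has_count cE muln_gt0 side_len_gt0 // andbT -subn1 subn_gt0.
have DgL : map_poly f (redp p g) = \prod_(x <- map red es) ('X - x%:P).
  rewrite /redp -map_poly_comp.
  rewrite (eq_map_poly (g := red \o intr)) => [|z /=]; last by rewrite !rmorph_int.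
  rewrite map_poly_comp Dg rmorph_prod big_map; apply: eq_bigr => x _.
  by rewrite rmorphB /= map_polyX map_polyC.
have g0 : redp p g != 0 by apply/monic_neq0/monic_map.
have gt0 : root (map_poly f (redp p g)) (red t0) by rewrite DgL root_prod_XsubC map_f.
have [G [monG irrG Gt0]] := exists_minpoly g0 gt0.
have [szG _] := irrG.
have [e [Q [DgQ GQ]]] := exists_multiplicity g0 szG.
have e0 : (0 < e)%N.
  rewrite lt0n; apply: contra GQ => /eqP e0; move: DgQ; rewrite e0 expr0 mul1r => <-.
  by rewrite -(irreducible_root_dvdp _ irrG Gt0).
have [Gt [Qt [Tt [DgT DG DQ GT]]]] := dedekind_uniformizer p_prime ded mong e0 monG szG DgQ GQ.
have yE t : evalp (H ^+ u + a%:P) t = theta t ^+ u + a%:~R.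
  by rewrite evalpD evalpX /evalp map_polyC hornerC.
have evg t : t \in es -> evalp (pl := pl) g t = 0.
  move=> tes; apply/eqP; rewrite /evalp Dg horner_prod.
  by rewrite (perm_big _ (perm_to_rem tes)) big_cons /= !hornerE subrr mul0r.
have [|||s vs] := val_uniform (f := f) (h := H ^+ u + a%:P) p_prime irrG e0 evg DgT DG.
- by rewrite DQ.
- by [].
- by move=> t tes _; rewrite yE y_neq0.
(* What holds at [t0] spreads to all roots of [G]: being a root of [phi \Po H] because that means
   divisibility by [G], being on the segment because the valuation of [theta ^ u + a] is constant by
   [val_uniform]. *)
have sub t : t \in es -> root (map_poly f G) (red t) ->
    root (map_poly f phi) (red (theta t)) &&
    in_side k V pl l (emb (theta t ^+ u + a%:~R)).
  move=> tes Gt'; apply/andP; split.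
    have : root (map_poly f (phi \Po redp p H)) (red t0).
      by rewrite /root horner_map_comp -red_evalp.
    rewrite (irreducible_root_dvdp _ irrG Gt0) -(irreducible_root_dvdp _ irrG Gt').
    by rewrite /root horner_map_comp -red_evalp.
  rewrite (in_side_val l _ (y_neq0 t0P)) ?y_neq0 //.
  by rewrite -!yE !vs.
have sl_e : (side_len p k V l <= e)%N.
  apply: (side_len_le p_gt2 _ _ in0 (y_neq0 t0P) e0 (s := s)) => //.
  by rewrite -yE vs.
exists G; split=> //; last by exists t0.
apply/eqP; rewrite eqn_leq; apply/andP; split; last first.
  apply: (leq_size_root_comp (H := redp p H) irrphi irrG Gt0).
  by rewrite -red_evalp.
have cG : count (fun t => root (map_poly f G) (red t)) es = (e * (size G).-1)%N.
  rewrite -(count_map red (root (map_poly f G))).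
  rewrite -(eq_count (a1 := root (map_poly f (G ^+ e)))) => [|x]; last first.
    by rewrite rmorphXn /= /root horner_exp expf_eq0 e0.
  rewrite (@count_root_split _ _ (map_poly f Q)).
  - by rewrite size_map_poly; have := size_exp G e; rewrite mulnC.
  - by rewrite -rmorphM -DgQ.
  move=> x; apply/negP; rewrite rmorphXn /= {1}/root horner_exp expf_eq0 e0 /=.
  by move=> /andP[Gx]; rewrite (irreducible_root_dvdp _ irrG Gx) (negPf GQ).
have lec : (e * (size G).-1 <= (size phi).-1 * side_len p k V l)%N.
  rewrite -cG -cE (eq_in_count (a2 := predI (fun t => root (map_poly f G) (red t))
    (fun t => root (map_poly f phi) (red (theta t)) &&
       in_side k V pl l (emb (theta t ^+ u + a%:~R))))).
    by apply: sub_count => t /andP[].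
  by move=> t tes /=; apply/idP/andP => [Gt'|[]//]; split=> //; apply: sub.
have := leq_of_mul_bounds e0 sl_e lec.
by rewrite -ltnS (prednK (ltnW szG)) (prednK (ltnW szphi)).
Qed.

End ClassCount.

(** * Counting *)

Lemma mem_monic_irr (p d : nat) (q : {poly_d.+1 'F_p}) : (q \in monic_irr p d) =
  [&& size q == d.+1, (q : {poly 'F_p}) \is monic & irreducibleb q].
Proof. by rewrite inE. Qed.

Lemma trinomial_monic (n m : nat) (a b : int) : (m < n)%N -> trinomial n m a b \is monic.
Proof.
move=> mn; rewrite /trinomial -addrA monicE lead_coefDl ?lead_coefXn // size_polyXn ltnS.
rewrite (leq_trans (size_polyD _ _)) // geq_max.
rewrite (leq_trans (size_scale_leq _ _)) ?size_polyXn //=.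
by rewrite (leq_trans (size_polyC_leq1 _)) // (leq_ltn_trans _ mn).
Qed.

Lemma size_trinomial (n m : nat) (a b : int) : (m < n)%N -> size (trinomial n m a b) = n.+1.
Proof.
move=> mn; rewrite /trinomial -addrA size_polyDl ?size_polyXn // ltnS.
rewrite (leq_trans (size_polyD _ _)) // geq_max.
rewrite (leq_trans (size_scale_leq _ _)) ?size_polyXn //=.
by rewrite (leq_trans (size_polyC_leq1 _)) // (leq_ltn_trans _ mn).
Qed.

(* The hypotheses on [V], [A1] and [b1] give the height [V] of the polygon at
   [0], which has then [V] segments. *)
Theorem monogenic_card_bound
  (n m : nat) (a b : int) (K : fieldExtType rat) (theta : K)
  (p u k d V : nat) (A1 b1 : int) :
  (0 < m)%N -> (m < n)%N ->
  irreducible_poly (map_poly intr (trinomial n m a b) : {poly rat}) ->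
  root (map_poly intr (trinomial n m a b)) theta ->
  <<1; theta>>%VS = fullv ->
  prime p -> (2 < p)%N -> ~~ (p %| `|a|)%N -> ~~ (p %| u)%N -> (0 < k)%N ->
  (n - m)%N = (u * p ^ k)%N ->
  (0 < V <= k.+1)%N ->
  a + (- a) ^+ (p ^ k)%N = (p ^ V)%N%:Z * A1 -> b = (p ^ V)%N%:Z * b1 ->
  monogenic K ->
  (V * #|[set q in monic_irr p d |
     ((q : {poly 'F_p}) %| 'X^u + (a%:~R)%:P)%R &&
     ((V <= k)%N ==> ~~ ((q : {poly 'F_p}) %| A1%:~R *: 'X^m + (b1%:~R)%:P)%R)]|
   <= nb_irr p d)%N.
Proof.
move=> m_gt0 lt_mn irrF theta_root theta_gen p_prime p_gt2 pNa pNu k_gt0 Dnm.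
move=> /andP[V_gt0 V_le] DA Db monoK.
have [g [H [etas [mong Dg DF ded]]]] :=
  monogenic_conjugates (trinomial_monic a b lt_mn) irrF theta_root theta_gen monoK.
have [pl] := place_exists p_prime.
have [f] := Fp_morphism (pl_pchar pl).
have Dn : n = (m + u * p ^ k)%N by rewrite -Dnm subnKC // ltnW.
have [es Des] := monic_roots_emb pl mong Dg.
have DgT : map_poly intr g = \prod_(t <- es) ('X - t%:P) :> {poly pl_ring pl}.
  by apply: prod_XsubC_emb; rewrite Dg Des big_map.
have DFT : map_poly intr (trinomial (m + u * p ^ k) m a b) =
    \prod_(t <- es) ('X - (evalp H t)%:P) :> {poly pl_ring pl}.
  apply: prod_XsubC_emb; rewrite -Dn DF Des big_map.
  by apply: eq_bigr => t _; rewrite emb_evalp.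
have u0 := ndvdn_gt0 pNu.
have lt_un : (u < n)%N.
  by rewrite Dn -add1n leq_add // leq_pmulr // expn_gt0 prime_gt0.
(* The irreducible [F] has degree [n > u], so it shares no root with [X ^ u + a]. *)
have y_neq0 t : t \in es -> pl_emb pl (evalp H t ^+ u + a%:~R) != 0.
  move=> tes; apply/negP => y0.
  have rF : root (map_poly ratr (map_poly intr (trinomial n m a b) : {poly rat}))
      (pl_emb pl (evalp H t)).
    rewrite -map_poly_intr_ratr -(map_intr_emb pl) Dn DFT /root horner_map horner_prod.
    by rewrite (perm_big _ (perm_to_rem tes)) big_cons /= !hornerE subrr mul0r rmorph0.
  have := irreducible_root_dvdp (map_poly intr ('X^u + a%:P)) irrF rF.
  rewrite -map_poly_intr_ratr rmorphD /= map_polyXn map_polyC /root !hornerE /=.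
  rewrite -rmorphXn -(rmorph_int (pl_emb pl)) -rmorphD y0 => /esym/dvdp_leq.
  have -> : map_poly intr ('X^u + a%:P) = 'X^u + a%:~R%:P :> {poly rat}.
    by rewrite rmorphD /= map_polyXn map_polyC.
  have sz : size ('X^u + (a%:~R)%:P : {poly rat}) = u.+1.
    by rewrite size_polyDl ?size_polyXn // ltnS (leq_trans (size_polyC_leq1 _)).
  have szF : size (map_poly intr (trinomial n m a b) : {poly rat}) = n.+1.
    rewrite size_map_inj_poly ?size_trinomial //; exact: intr_inj.
  rewrite sz szF ltnS leqNgt lt_un -size_poly_gt0 sz => h.
  by have := h isT.
set S := [set q in _ | _].
(* The implication is inside the existential so that choice yields a total map [Phi], with a dummy
   value outside [S]. *)
have exG (x : {poly_d.+1 'F_p} * 'I_V) : exists y : {poly_d.+1 'F_p}, x.1 \in S ->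
    [/\ y \in monic_irr p d,
      exists2 t, t \in es & root (map_poly f y) (pl_red pl t)
    & forall t, t \in es -> root (map_poly f y) (pl_red pl t) ->
        root (map_poly f x.1) (pl_red pl (evalp H t)) &&
        in_side k V pl x.2 (pl_emb pl (evalp H t ^+ u + a%:~R))].
  case: x => q l /=; have [qS|qS] := boolP (q \in S); last by exists q.
  move: qS; rewrite inE mem_monic_irr => /andP[/and3P[/eqP szq monq /irreducibleP irrq]].
  move=> /andP[qX /implyP good].
  have [G [monG irrG szG exG subG]] :=
    side_prime p_prime p_gt2 f pNa pNu k_gt0 V_gt0 V_le DA Db DFT mong DgT
      (fun e G Q T T1 T2 => @ded p e G Q T T1 T2 p_prime) y_neq0 irrq qX good (ltn_ord l).
  have szGd : (size G <= d.+1)%N by rewrite szG szq.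
  exists (NPoly szGd) => _; split=> //.
  by rewrite mem_monic_irr /= szG szq eqxx monG; apply/irreducibleP.
pose Phi x := sval (cid (exG x)).
have PhiP x := svalP (cid (exG x)).
have cS : #|finset.setX S [set: 'I_V]| = (V * #|S|)%N by rewrite cardsX cardsT card_ord mulnC.
rewrite -cS -(card_in_imset (f := Phi)).
  rewrite /nb_irr; apply/subset_leq_card/fintype.subsetP => _ /imsetP[x + ->].
  by case: x => q l /finset.setXP[qS _]; case: (PhiP (q, l) qS).
(* A conjugate reducing to a root of the common value lies in both classes: [q] and [q'] are monic
   irreducible with a common root, and a point is on one segment only. *)
move=> [q l] [q' l'] /finset.setXP[qS _] /finset.setXP[q'S _] e.
have [_ [t tes Gt] sub] := PhiP (q, l) qS; have [_ _ sub'] := PhiP (q', l') q'S.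
have /andP[rq inl] := sub t tes Gt.
have /andP[rq' inl'] := sub' t tes (eq_ind _ (fun y : {poly_d.+1 'F_p} =>
  root (map_poly f y) (pl_red pl t)) Gt _ e).
move: qS q'S; rewrite !inE => /andP[/and3P[_ mq /irreducibleP iq] _].
move=> /andP[/and3P[_ mq' /irreducibleP iq'] _].
congr (_, _); apply: val_inj => /=; last exact: (in_side_inj p_gt2 V_gt0 V_le inl inl').
apply/eqP; rewrite -eqp_monic // /eqp.
by rewrite -(irreducible_root_dvdp _ iq rq) rq' -(irreducible_root_dvdp _ iq' rq') rq.
Qed.

(** * From the valuations [delta] and [kappa] to the parameters of the bound *)

Lemma padic_val_ge (p i : nat) (z : int) : (i%:Z%:E <= padic_val p z)%E ->
  exists z', z = (p ^ i)%N%:Z * z'.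
Proof.
rewrite /padic_val; case: eqP => [-> _|/eqP z0]; first by exists 0; rewrite mulr0.
rewrite lee_fin lez_nat => le_i.
exists (sgz z * (`|z| %/ p ^ i)%N); rewrite mulrCA -PoszM mulnC divnK.
  by rewrite -intEsg.
by rewrite (dvdn_trans (dvdn_exp2l p le_i)) // pfactor_dvdnn.
Qed.

Lemma padic_val_eq (p i : nat) (z : int) : prime p -> padic_val p z = i%:Z%:E ->
  exists2 z', z = (p ^ i)%N%:Z * z' & ~~ (p %| `|z'|)%N.
Proof.
move=> p_pr vz; have [|z' Dz] := @padic_val_ge p i z; first by rewrite vz.
exists z' => //; apply/negP => /dvdnP[w Dw]; move: vz; rewrite /padic_val.
case: eqP => // /eqP z0 [e].
have : (p ^ i.+1 %| `|z|)%N by rewrite Dz abszM Dw mulnCA mulnC -expnSr dvdn_mulr.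
by rewrite pfactor_dvdn ?absz_gt0 // e ltnn.
Qed.

Lemma padic_val_fin (p i : nat) (z : int) : (padic_val p z < i%:Z%:E)%E ->
  exists2 j, padic_val p z = j%:Z%:E & (j < i)%N.
Proof.
rewrite /padic_val; case: eqP => //= _; rewrite lte_fin ltz_nat => lt.
by exists (logn p `|z|%N).
Qed.

Lemma padic_val_gt (p i : nat) (z : int) : (i%:Z%:E < padic_val p z)%E ->
  (i.+1%:Z%:E <= padic_val p z)%E.
Proof.
by rewrite /padic_val; case: eqP => [_ _|_]; rewrite ?leey // lte_fin lee_fin ltz_nat lez_nat.
Qed.

Lemma ltn_of_lte (N i M : nat) : (N%:Z%:E < i%:Z%:E * M%:Z%:E)%E -> (N < i * M)%N.
Proof. by rewrite -EFinM lte_fin -PoszM ltz_nat. Qed.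

Lemma Fp_expr_pred (p : nat) (a : int) : prime p -> ~~ (p %| `|a|)%N ->
  a%:~R ^+ p.-1 = 1 :> 'F_p.
Proof.
move=> p_pr pNa; have a0 : a%:~R != 0 :> 'F_p by rewrite Fp_int_eq0.
apply: (mulfI a0); rewrite mulr1 -exprS prednK ?prime_gt0 //.
by have := expf_card (a%:~R : 'F_p); rewrite card_Fp.
Qed.

(* Lifting the exponent: [p ^ k - 1 = (p - 1) M] with [M = 1] mod [p]. *)
Lemma add_pow_factor (p k : nat) (a : int) : prime p -> odd p -> (0 < k)%N ->
    ~~ (p %| `|a|)%N ->
  exists2 c : int, a + (- a) ^+ (p ^ k)%N = (a ^+ p.-1 - 1) * c & ~~ (p %| `|c|)%N.
Proof.
move=> p_pr p_odd k0 pNa; have p_gt0 := prime_gt0 p_pr.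
have pk0 : (0 < p ^ k)%N by rewrite expn_gt0 p_gt0.
set M := (\sum_(i < k) p ^ i)%N.
have DM : (p ^ k).-1 = (p.-1 * M)%N by rewrite predn_exp.
(* For odd [p], [a + (- a) ^ (p ^ k) = - a (a ^ ((p - 1) M) - 1)]; the geometric sum has [M] terms,
   each 1 mod [p] by Fermat. *)
exists (- a * \sum_(i < M) (a ^+ p.-1) ^+ i).
  rewrite exprNn -signr_odd oddX p_odd orbT expr1 mulN1r -(prednK pk0) exprS DM exprM.
  by rewrite mulrCA -subrX1; ring.
have a0 : a%:~R != 0 :> 'F_p by rewrite Fp_int_eq0.
rewrite -Fp_int_eq0 // rmorphM rmorphN mulf_neq0 ?oppr_eq0 //.
rewrite rmorph_sum (eq_bigr (fun=> 1)) => [|i _]; last first.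
  by rewrite !rmorphXn /= Fp_expr_pred // expr1n.
rewrite sumr_const card_ord /M natr_sum; case: k k0 {pk0 M DM} => // k _.
rewrite big_ord_recl expn0 big1 ?addr0 ?oner_eq0 // => i _.
by apply/eqP; rewrite -(dvdn_pcharf (pchar_Fp p_pr)) dvdn_exp.
Qed.

Lemma irreducible_ndvd_scaleXn (F : fieldType) (q : {poly F}) (a c : F) (u m : nat) :
    irreducible_poly q -> (0 < u)%N -> a != 0 -> c != 0 -> q %| 'X^u + a%:P ->
  ~~ (q %| c *: 'X^m).
Proof.
move=> [szq irrq] u0 a0 c0 qX; rewrite dvdpZr //; apply/negP => qXm.
have co : coprimep ('X^u + a%:P) 'X^m.
  apply: coprimep_expr; have := coprimep_XsubC ('X^u + a%:P) 0.
  rewrite polyC0 subr0 => ->.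
  by rewrite /root hornerD hornerXn hornerC expr0n eqn0Ngt u0 add0r.
have /coprimepP/(_ q qX qXm) := co.
by rewrite -size_poly_eq1 gtn_eqF.
Qed.

(** [ratr] works with the reduced form of the fraction, whose denominator is prime to [p] as [w]
    is. *)
Lemma ratr_Fp (p : nat) (z w : int) : prime p -> ~~ (p %| `|w|)%N ->
  ratr (z%:~R / w%:~R : rat) = z%:~R / w%:~R :> 'F_p.
Proof.
move=> p_pr pNw; set c : rat := _ / _; have w0 : w%:~R != 0 :> rat.
  by rewrite intr_eq0; apply: contraNneq pNw => ->; rewrite dvdn0.
have e : numq c * w = z * denq c.
  apply: (@intr_inj rat); rewrite !intrM; apply/eqP.
  rewrite -eqr_div ?intr_eq0 ?denq_eq0 -?(intr_eq0 rat) //.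
  by rewrite divq_num_den.
have w0' : w%:~R != 0 :> 'F_p by rewrite Fp_int_eq0.
have d0 : (denq c)%:~R != 0 :> 'F_p.
  rewrite Fp_int_eq0 //; apply/negP => pd.
  have : (p %| `|numq c| * `|w|)%N by rewrite -abszM e abszM dvdn_mull.
  rewrite Euclid_dvdM // (negPf pNw) orbF => pn.
  have := coprime_num_den c => /eqP g1.
  have : (p %| gcdn `|numq c| `|denq c|)%N by rewrite dvdn_gcd pn.
  by rewrite g1 dvdn1 => /eqP p1; rewrite p1 in p_pr.
rewrite /ratr; apply/eqP; rewrite eqr_div // -!intrM e.
by [].
Qed.
Theorem theorem2p7
  (n m : nat) (a b : int) (K : fieldExtType rat) (theta : K)
  (p u k d : nat) (delta kappa : \bar int)
  (m_gt0 : (0 < m)%N) (lt_m_n : (m < n)%N)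
  (irrF : irreducible_poly (map_poly intr (trinomial n m a b) : {poly rat}))
  (theta_root : root (map_poly intr (trinomial n m a b)) theta)
  (theta_gen : <<1; theta>>%VS = fullv)
  (p_prime : prime p) (p_odd : odd p)
  (p_ndvd_a : ~~ (p%:Z %| a)%Z) (p_dvd_b : (p%:Z %| b)%Z)
  (p_dvd_nm : (p %| n - m)%N)
  (def_nm : (n - m)%N = (u * p ^ k)%N) (p_ndvd_u : ~~ (p %| u)%N)
  (def_delta : delta = padic_val p b)
  (def_kappa : kappa = padic_val p (a ^+ p.-1 - 1))
  (d_gt0 : (0 < d)%N)
  (cond :
    [\/ (delta < Order.min kappa (k.+1%:Z)%:E)%E /\
        (((nb_irr p d)%:Z)%:E
           < delta * ((nb_irr_factors p d u a)%:Z)%:E)%E,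
        (kappa < Order.min delta (k.+1%:Z)%:E)%E /\
        (((nb_irr p d)%:Z)%:E
           < kappa * ((nb_irr_factors p d u a)%:Z)%:E)%E,
        [/\ kappa = delta, (delta <= (k%:Z)%:E)%E &
            (((nb_irr p d)%:Z)%:E
               < kappa * ((nb_irr_factors_ndvd p d u a m
                   (b%:~R / (a + (- a) ^+ (p ^ k)%N)%:~R))%:Z)%:E)%E] |
        ((k.+1%:Z)%:E <= Order.min kappa delta)%E /\
        (nb_irr p d < k.+1 * nb_irr_factors p d u a)%N]) :
  ~ monogenic K.

Proof.
move=> monoK.
have p_gt2 : (2 < p)%N.
  by rewrite ltn_neqAle prime_gt1 // andbT; apply: contraTneq p_odd => <-.
have k_gt0 : (0 < k)%N.
  rewrite lt0n; apply: contraNneq p_ndvd_u => k0.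
  by move: p_dvd_nm; rewrite def_nm k0 expn0 muln1.
have pNa : ~~ (p %| `|a|)%N := p_ndvd_a.
have [c Dc pNc] := add_pow_factor p_prime p_odd k_gt0 pNa.
have bound V A1 b1 : (0 < V <= k.+1)%N ->
    a + (- a) ^+ (p ^ k)%N = (p ^ V)%N%:Z * A1 -> b = (p ^ V)%N%:Z * b1 ->
  (V * #|[set q in monic_irr p d |
     ((q : {poly 'F_p}) %| 'X^u + (a%:~R)%:P)%R &&
     ((V <= k)%N ==> ~~ ((q : {poly 'F_p}) %| A1%:~R *: 'X^m + (b1%:~R)%:P)%R)]|
   <= nb_irr p d)%N.
  move=> V_rng DA Db.
  exact: (monogenic_card_bound d m_gt0 lt_m_n irrF theta_root theta_gen
    p_prime p_gt2 pNa p_ndvd_u k_gt0 def_nm V_rng DA Db monoK).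
have too_many V N (S : {set {poly_d.+1 'F_p}}) : (V * #|S| <= nb_irr p d)%N ->
    (nb_irr p d < V * N)%N -> (N <= #|S|)%N -> False.
  move=> le1 lt2 le3; have := leq_trans lt2 (leq_trans _ le1).
  by rewrite leq_mul2l le3 orbT ltnn => /(_ isT).
have irr_size (q : {poly_d.+1 'F_p}) : q \in monic_irr p d -> size q = d.+1.
  by rewrite mem_monic_irr => /andP[/eqP].
have delta_gt0 i : delta = i%:Z%:E -> (0 < i)%N.
  rewrite def_delta /padic_val; case: eqP => // /eqP b0 [<-].
  by rewrite logn_gt0 mem_primes p_prime absz_gt0 b0.
have kappa_gt0 i : kappa = i%:Z%:E -> (0 < i)%N.
  rewrite def_kappa /padic_val; case: eqP => // /eqP z0 [<-].
  rewrite logn_gt0 mem_primes p_prime absz_gt0 z0 /= -Fp_int_eq0 //.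
  by rewrite rmorphB rmorphXn /= Fp_expr_pred // subrr.
have u_gt0 := ndvdn_gt0 p_ndvd_u.
have a_neq0 : a%:~R != 0 :> 'F_p by rewrite Fp_int_eq0.
case: cond => [[+ ltN]|[+ ltN]|[kd le_k ltN]|[+ ltN]].
(* [V = delta]: [A1] vanishes mod [p] and [b1] does not, so the excluded polynomial is a nonzero
   constant and excludes no factor, [d] being positive. *)
- rewrite lt_min => /andP[lt_dk lt_d].
  have [i Di lt_i] := padic_val_fin (eq_ind _ (fun x => x < _)%E lt_d _ def_delta).
  have [b1 Db pNb1] := padic_val_eq p_prime Di.
  have Ddi : delta = i%:Z%:E by rewrite def_delta.
  rewrite Ddi in ltN lt_dk; rewrite def_kappa in lt_dk.
  have [z Dz] := padic_val_ge (padic_val_gt lt_dk).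
  have DA : a + (- a) ^+ (p ^ k)%N = (p ^ i)%N%:Z * (p%:Z * z * c).
    by rewrite Dc Dz expnSr PoszM; ring.
  have i_rng : (0 < i <= k.+1)%N by rewrite (delta_gt0 _ Ddi) ltnW.
  apply: (too_many _ _ _ (bound i _ b1 i_rng DA Db) (ltn_of_lte ltN)).
  apply/subset_leq_card/fintype.subsetP => q; rewrite !inE => /andP[qm qX].
  rewrite qm qX; apply/implyP => _.
  have -> : (p%:Z * z * c)%:~R = 0 :> 'F_p by rewrite !intrM Fp_p_eq0 // !mul0r.
  rewrite scale0r add0r; apply/negP => /dvdp_leq; rewrite polyC_eq0 Fp_int_eq0 //.
  move=> /(_ pNb1); rewrite size_polyC Fp_int_eq0 // pNb1.
  by case/andP: qm => /eqP-> _; rewrite ltnNge d_gt0.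
(* [V = kappa]: now [b1] vanishes mod [p], and the factors of [X ^ u + a] are prime to the remaining
   [A1 X ^ m]. *)
- rewrite lt_min => /andP[lt_kd lt_k].
  have [i Di lt_i] := padic_val_fin (eq_ind _ (fun x => x < _)%E lt_k _ def_kappa).
  have [z Dz pNz] := padic_val_eq p_prime Di.
  have Dki : kappa = i%:Z%:E by rewrite def_kappa.
  rewrite Dki in ltN lt_kd; rewrite def_delta in lt_kd.
  have [b1 Db1] := padic_val_ge (padic_val_gt lt_kd).
  have DA : a + (- a) ^+ (p ^ k)%N = (p ^ i)%N%:Z * (z * c) by rewrite Dc Dz mulrA.
  have Db : b = (p ^ i)%N%:Z * (p%:Z * b1) by rewrite Db1 expnSr PoszM mulrA.
  have i_rng : (0 < i <= k.+1)%N by rewrite (kappa_gt0 _ Dki) ltnW.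
  apply: (too_many _ _ _ (bound i _ _ i_rng DA Db) (ltn_of_lte ltN)).
  apply/subset_leq_card/fintype.subsetP => q; rewrite !inE => /andP[qm qX].
  rewrite qm qX; apply/implyP => _.
  have -> : (p%:Z * b1)%:~R = 0 :> 'F_p by rewrite intrM Fp_p_eq0 // mul0r.
  rewrite addr0; case/and3P: qm => _ _ /irreducibleP irrq.
  apply: (irreducible_ndvd_scaleXn m irrq u_gt0 a_neq0 _ qX).
  by rewrite Fp_int_eq0 // abszM Euclid_dvdM // negb_or pNz.
(* [V = kappa = delta]: both [A1] and [b1] are units mod [p], and [A1 X ^ m + b1] is [A1] times the
   binomial of condition (3). *)
- have [i Di lt_i] : exists2 i, delta = i%:Z%:E & (i <= k)%N.
    have [|i Di lt_i] := @padic_val_fin p k.+1 b.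
      by rewrite -def_delta (le_lt_trans le_k) // lte_fin ltz_nat.
    by exists i; rewrite // def_delta.
  have [b1 Db pNb1] : exists2 b1, b = (p ^ i)%N%:Z * b1 & ~~ (p %| `|b1|)%N.
    by apply: padic_val_eq => //; rewrite -def_delta.
  have [z Dz pNz] := padic_val_eq p_prime (etrans (esym def_kappa) (etrans kd Di)).
  have DA : a + (- a) ^+ (p ^ k)%N = (p ^ i)%N%:Z * (z * c) by rewrite Dc Dz mulrA.
  have pNA : ~~ (p %| `|(z * c)%R|)%N by rewrite abszM Euclid_dvdM // negb_or pNz.
  have i_rng : (0 < i <= k.+1)%N by rewrite (delta_gt0 _ Di) (leq_trans lt_i).
  rewrite kd Di in ltN.
  apply: (too_many _ _ _ (bound i _ _ i_rng DA Db) (ltn_of_lte ltN)).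
  have pi0 : (p ^ i)%N%:Z%:~R != 0 :> rat.
    by rewrite intr_eq0 eqz_nat -lt0n expn_gt0 prime_gt0.
  have -> : b%:~R / (a + (- a) ^+ (p ^ k)%N)%:~R = b1%:~R / (z * c)%:~R :> rat.
    by rewrite DA {1}Db !intrM -mulf_div divff // mul1r.
  apply/subset_leq_card/fintype.subsetP => q; rewrite !inE => /andP[qm /andP[qX qN]].
  rewrite qm qX lt_i /=; move: qN; rewrite ratr_Fp //.
  have A0 : (z * c)%:~R != 0 :> 'F_p by rewrite Fp_int_eq0.
  suff <- : (z * c)%:~R *: ('X^m + (b1%:~R / (z * c)%:~R)%:P) =
      (z * c)%:~R *: 'X^m + b1%:~R%:P :> {poly 'F_p} by rewrite dvdpZr.
  by rewrite scalerDr -[_ *: _%:P]mul_polyC -polyCM mulrCA mulfV // mulr1.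
(* [V = k + 1]: the exclusion clause is void, and [delta] or [kappa] may be infinite. *)
- rewrite le_min => /andP[le_kk le_kd]; rewrite def_kappa in le_kk; rewrite def_delta in le_kd.
  have [z Dz] := padic_val_ge le_kk; have [b1 Db] := padic_val_ge le_kd.
  have DA : a + (- a) ^+ (p ^ k)%N = (p ^ k.+1)%N%:Z * (z * c) by rewrite Dc Dz mulrA.
  apply: (too_many _ _ _ (bound k.+1 _ b1 _ DA Db) ltN); first by rewrite leqnn.
  apply/subset_leq_card/fintype.subsetP => q; rewrite !inE => /andP[qm qX].
  by rewrite qm qX ltnn.
Qed.
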